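(* Let $p\in S^{\rm inv}_{\bar m}(\mathfrak C,M)$ be generically stable over $M$ and assume $(\diamondsuit)$ holds for $\mu=\delta_p$, i.e. for every $\sigma\in\mathrm{Aut}(\mathfrak C')$ with $\mathrm{tp}(\sigma(\bar m)/\mathfrak C)=p$, the type $p|_{\mathfrak C'}$ is $\sigma^{-1}[M]$-invariant. Let $\pi(\bar x;\bar y)\vdash\bar x\equiv_\emptyset\bar y$ be a partial type over $\emptyset$ with $\mathrm{stab}(p)=G_{\pi,\mathfrak C}$. Then the following are equivalent: (1) $p$ is idempotent, i.e. $p*p=p$; (2) $p$ is the unique left $G_{\pi,\mathfrak C}$-invariant type in $S^{\rm inv}_{\pi(\bar x;\bar m)}(\mathfrak C,M)$.
   Context: $T$ is a complete first-order theory, $\mathfrak C$ a monster model, $\mathfrak C'\succeq\mathfrak C$ a larger monster model. $M\preceq\mathfrak C$ is a small model enumerated as $\bar m$; $\bar x,\bar y$ are copies of the variable tuple for $\bar m$. $S_{\bar m}(\mathfrak C)$ is the set of global types extending $\mathrm{tp}(\bar m/\emptyset)$, each of the form $\mathrm{tp}(\sigma(\bar m)/\mathfrak C)$ with $\sigma\in\mathrm{Aut}(\mathfrak C')$; $S^{\rm inv}_{\bar m}(\mathfrak C,M)$ is the set of $M$-invariant ones, and $S^{\rm inv}_{\pi(\bar x;\bar m)}(\mathfrak C,M)$ those which moreover contain $\pi(\bar x;\bar m)$. For $M$-invariant $p$, $p|_{\mathfrak C'}$ is its unique $M$-invariant extension to $\mathfrak C'$. The $*$-product: for $q=\mathrm{tp}(\tau(\bar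 m)/\mathfrak C)$ with $\tau\in\mathrm{Aut}(\mathfrak C')$, $p*q=(\tau\cdot p|_{\mathfrak C'})|_{\mathfrak C}$. $\mathrm{stab}(p)=\{\sigma\in\mathrm{Aut}(\mathfrak C):\sigma\cdot p=p\}$, $G_{\pi,\mathfrak C}=\{\sigma\in\mathrm{Aut}(\mathfrak C):\models\pi(\sigma(\bar m);\bar m)\}$. Generically stable over $M$ means: $\delta_p$ is a fim measure over $M$ (for every $\mathcal L$-formula $\varphi(\bar x_0;\bar y)$ with $\bar x_0\subseteq\bar x$ finite there are $\mathcal L(M)$-formulas $\theta_n(\bar x_1,\dots,\bar x_n)$ such that for each $\varepsilon>0$, for large $n$ every $\bar a\models\theta_n$ satisfies $\sup_{\bar b}|\mathrm{Av}(\bar a)(\varphi(\bar x_0;\bar b))-\delta_p(\varphi(\bar x_0;\bar b))|<\varepsilon$, and $p^{(n)}\vdash\theta_n$ for large $n$). *)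

(* Defs.v *)
From mathcomp Require Import all_boot all_order all_algebra.
From mathcomp Require Import all_classical all_reals.
Set Implicit Arguments.
Unset Strict Implicit.
Unset Printing Implicit Defensive.
Import Order.TTheory GRing.Theory Num.Theory.
Local Open Scope classical_set_scope.
Local Open Scope ring_scope.
Local Open Scope card_scope.

Record language := Language {
  fsym : Type;
  farity : fsym -> nat;
  rsym : Type;
  rarity : rsym -> nat
}.

Inductive term (L : language) (V : Type) : Type :=
| Var of V
| Fun (f : fsym L) of 'I_(farity f) -> term L V.

(** [formula L V]: L-formulas whose free variables lie in [V].  A quantifier
    binds the extra variable [None] of [option V]. *)
Inductive formula (L : language) (V : Type) : Type :=
| FFalse
| FEq of term L V & term L V
| FRel (r : rsym L) of 'I_(rarity r) -> term L V
| FImp of formula L V & formula L V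
| FAll of formula L (option V).

Arguments Var {L V}.
Arguments Fun {L V}.
Arguments FFalse {L V}.
Arguments FEq {L V}.
Arguments FRel {L V}.
Arguments FImp {L V}.
Arguments FAll {L V}.

Definition FNot (L : language) (V : Type) (phi : formula L V) : formula L V :=
  FImp phi FFalse.

Fixpoint tren (L : language) (V W : Type) (f : V -> W) (t : term L V) :
    term L W :=
  match t with
  | Var x => Var (f x)
  | Fun g args => Fun g (fun i => tren f (args i))
  end.

Fixpoint ren (L : language) (V W : Type) (f : V -> W) (phi : formula L V) :
    formula L W :=
  match phi with
  | FFalse => FFalse
  | FEq t u => FEq (tren f t) (tren f u)
  | FRel r args => FRel r (fun i => tren f (args i))
  | FImp phi psi => FImp (ren f phi) (ren f psi)
  | FAll phi => FAll (ren (omap f) phi)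
  end.

Record structure (L : language) := Structure {
  carrier :> Type;
  carrier_inhabited : inhabited carrier;
  fint : forall f : fsym L, ('I_(farity f) -> carrier) -> carrier;
  rint : forall r : rsym L, ('I_(rarity r) -> carrier) -> Prop
}.

Fixpoint teval (L : language) (S : structure L) (V : Type) (v : V -> S)
    (t : term L V) : S :=
  match t with
  | Var x => v x
  | Fun f args => fint (fun i => teval v (args i))
  end.

Fixpoint sat (L : language) (S : structure L) (V : Type) (phi : formula L V)
    (v : V -> S) : Prop :=
  match phi with
  | FFalse => False
  | FEq t u => teval v t = teval v u
  | FRel r args => rint (fun i => teval v (args i))
  | FImp phi psi => sat phi v -> sat psi v
  | FAll phi => forall d : S, sat phi (fun o => if o is Some x then v x else d)
  end.

Definition theory (L : language) := set (formula L void).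

Definition models (L : language) (S : structure L) (T : theory L) : Prop :=
  forall (phi : formula L void) (v : void -> S), T phi -> sat phi v.

Definition entails (L : language) (T : theory L) (phi : formula L void) : Prop :=
  forall (S : structure L) (v : void -> S), models S T -> sat phi v.

Definition complete_theory (L : language) (T : theory L) : Prop :=
  (exists S : structure L, models S T) /\
  (forall phi : formula L void, entails T phi \/ entails T (FNot phi)).

Record elem_emb (L : language) (S S' : structure L) := ElemEmb {
  emb_fun :> S -> S';
  emb_elementary : forall (V : Type) (phi : formula L V) (v : V -> S),
    sat phi v <-> sat phi (emb_fun \o v)
}.

Record aut (L : language) (S : structure L) := Aut {
  aut_fun :> S -> S;
  aut_bij : bijective aut_fun;
  aut_fint : forall (f : fsym L) (v : 'I_(farity f) -> S),
    aut_fun (fint v) = fint (aut_fun \o v);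
  aut_rint : forall (r : rsym L) (v : 'I_(rarity r) -> S),
    rint (aut_fun \o v) <-> rint v
}.

(** Cardinals are represented by types. *)
Definition card_lt (T U : Type) (A : set T) (B : set U) : Prop :=
  (A #<= B) /\ ~ (B #<= A).

Definition strong_limit (kappa : Type) : Prop :=
  forall A : set kappa, card_lt A [set: kappa] ->
    card_lt [set X : set kappa | X `<=` A] [set: kappa].

Definition sum_case (V W X : Type) (f : V -> X) (g : W -> X) (z : V + W) : X :=
  match z with inl x => f x | inr y => g y end.

Definition sum_map (V W V' W' : Type) (f : V -> V') (g : W -> W') :
    V + W -> V' + W' :=
  sum_case (inl \o f) (inr \o g).

(** An L(A)-formula in the variables [V] is an element of [formula L (V + A)]:
    the parameters are variables which are evaluated to themselves. *)

Definition saturated (L : language) (kappa : Type) (S : structure L) : Prop :=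
  forall (A : set S) (p : set (formula L (unit + A))),
    card_lt A [set: kappa] ->
    (forall F : set (formula L (unit + A)), finite_set F -> F `<=` p ->
       exists c : S, forall phi, F phi ->
         sat phi (sum_case (fun=> c) set_val)) ->
    exists c : S, forall phi, p phi -> sat phi (sum_case (fun=> c) set_val).

Definition strongly_homogeneous (L : language) (kappa : Type)
    (S : structure L) : Prop :=
  forall (A : set S) (f : A -> S),
    card_lt A [set: kappa] ->
    (forall phi : formula L A, sat phi (set_val : A -> S) <-> sat phi f) ->
    exists sigma : aut S, forall a : A, sigma (set_val a) = f a.

(** |T| is the number of L-formulas. *)
Record monster (L : language) (kappa : Type) (S : structure L) : Prop := {
  monster_card : card_lt [set: formula L nat] [set: kappa];
  monster_strong_limit : strong_limit kappa;
  monster_saturated : saturated kappa S;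
  monster_homogeneous : strongly_homogeneous kappa S
}.

Definition complete_type (L : language) (S : structure L) (I : Type)
    (p : set (formula L (I + S))) : Prop :=
  (forall F : set (formula L (I + S)), finite_set F -> F `<=` p ->
     exists a : I -> S, forall phi, F phi -> sat phi (sum_case a id)) /\
  (forall phi, p phi \/ p (FNot phi)).

(** tp(a/S) for a tuple [a] in an elementary extension of [S]. *)
Definition tp (L : language) (S S' : structure L) (e : elem_emb S S') (I : Type)
    (a : I -> S') : set (formula L (I + S)) :=
  [set phi | sat phi (sum_case a e)].

(** sigma.p, the set of the phi(x, sigma(c)) for phi(x, c) in p. *)
Definition act (L : language) (S : structure L) (I : Type) (sigma : aut S)
    (p : set (formula L (I + S))) : set (formula L (I + S)) :=
  ren (sum_map id sigma) @` p.

Definition invariant_over (L : language) (S : structure L) (I : Type) (A : set S)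
    (p : set (formula L (I + S))) : Prop :=
  forall sigma : aut S, (forall a, A a -> sigma a = a) -> act sigma p = p.

Definition restrict_type (L : language) (S S' : structure L) (e : elem_emb S S')
    (I : Type) (p : set (formula L (I + S'))) : set (formula L (I + S)) :=
  [set phi | p (ren (sum_map id e) phi)].

(** For an M-invariant type [p] over the monster [C], the type p|C': since
    there is exactly one M-invariant complete type over [C'] extending [p],
    the union below is that type. *)
Definition ext (L : language) (C C' M : structure L) (e : elem_emb C C')
    (j : elem_emb M C) (I : Type) (p : set (formula L (I + C))) :
    set (formula L (I + C')) :=
  [set phi | exists p' : set (formula L (I + C')),
     [/\ complete_type p', invariant_over (range (e \o j)) p',
         restrict_type e p' = p & p' phi]].

(** The product p * q, where m : I -> M enumerates M.  The value does not depend
    on tau. *)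
Definition star (L : language) (C C' M : structure L) (e : elem_emb C C')
    (j : elem_emb M C) (I : Type) (m : I -> M)
    (p q : set (formula L (I + C))) : set (formula L (I + C)) :=
  [set phi | exists tau : aut C',
     tp e (tau \o e \o j \o m) = q /\ restrict_type e (act tau (ext e j p)) phi].

Definition idempotent_type (L : language) (C C' M : structure L)
    (e : elem_emb C C') (j : elem_emb M C) (I : Type) (m : I -> M)
    (p : set (formula L (I + C))) : Prop :=
  star e j m p p = p.

Definition Sinv (L : language) (C M : structure L) (j : elem_emb M C) (I : Type)
    (m : I -> M) (p : set (formula L (I + C))) : Prop :=
  [/\ complete_type p,
      (forall phi : formula L I, sat phi (j \o m) -> p (ren inl phi)) &
      invariant_over (range j) p].

(** In [pi : set (formula L (I + I))] the left summand indexes x and the right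
    one y. *)
Definition Sinv_pi (L : language) (C M : structure L) (j : elem_emb M C)
    (I : Type) (m : I -> M) (pi : set (formula L (I + I)))
    (p : set (formula L (I + C))) : Prop :=
  Sinv j m p /\
  forall psi, pi psi -> p (ren (sum_map id (j \o m)) psi).

Definition stab (L : language) (C : structure L) (I : Type)
    (p : set (formula L (I + C))) : set (aut C) :=
  [set sigma : aut C | act sigma p = p].

Definition Gpi (L : language) (C M : structure L) (j : elem_emb M C) (I : Type)
    (m : I -> M) (pi : set (formula L (I + I))) : set (aut C) :=
  [set sigma : aut C | forall psi, pi psi ->
     sat psi (sum_case (sigma \o j \o m) (j \o m))].

Definition left_invariant (L : language) (C : structure L) (I : Type)
    (G : set (aut C)) (p : set (formula L (I + C))) : Prop :=
  forall sigma, G sigma -> act sigma p = p.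

Definition partial_type (L : language) (T : theory L) (V : Type)
    (pi : set (formula L V)) : Prop :=
  exists (S : structure L) (v : V -> S),
    models S T /\ forall psi, pi psi -> sat psi v.

(** pi(x; y) |- x \equiv_\emptyset y, modulo T *)
Definition entails_equiv (L : language) (T : theory L) (I : Type)
    (pi : set (formula L (I + I))) : Prop :=
  forall (S : structure L) (a b : I -> S), models S T ->
    (forall psi, pi psi -> sat psi (sum_case a b)) ->
    forall phi : formula L I, sat phi a <-> sat phi b.

(** p(x) (x) q(y): the formulas phi(x, y, c) with phi(x, b, c) in p|C', where
    b realizes q in C'. *)
Definition morley_prod (L : language) (C C' M : structure L) (e : elem_emb C C')
    (j : elem_emb M C) (I J : Type) (p : set (formula L (I + C)))
    (q : set (formula L (J + C))) : set (formula L ((I + J) + C)) :=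
  [set phi | exists b : J -> C', tp e b = q /\
     ext e j p (ren (sum_case (sum_map id b) (inr \o e)) phi)].

Definition split_last (n : nat) (I : Type) (z : 'I_n.+1 * I) : I + 'I_n * I :=
  if unlift ord_max z.1 is Some k then inr (k, z.2) else inl z.2.

(** p^(n), with p^(n+1)(x_0, ..., x_n) = p(x_n) (x) p^(n)(x_0, ..., x_(n-1)) and
    p^(0) the type of the empty tuple; the i-th variable of the k-th copy of x
    is (k, i). *)
Fixpoint morley_pow (L : language) (C C' M : structure L) (e : elem_emb C C')
    (j : elem_emb M C) (I : Type) (p : set (formula L (I + C))) (n : nat) :
    set (formula L ('I_n * I + C)) :=
  match n with
  | 0 => [set phi | exists a : 'I_0 * I -> C, sat phi (sum_case a id)]
  | n'.+1 => [set phi |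
      morley_prod e j p (@morley_pow _ _ _ _ e j _ p n')
        (ren (sum_map (@split_last n' I) id) phi)]
  end.

Arguments morley_pow {L C C' M} e j {I} p n _.

Definition delta (R : realType) (L : language) (C : structure L) (I : Type)
    (p : set (formula L (I + C))) (phi : formula L (I + C)) : R :=
  (`[< p phi >] : nat)%:R.

Definition Av (R : realType) (L : language) (C : structure L) (I : Type)
    (n : nat) (a : 'I_n * I -> C) (phi : formula L (I + C)) : R :=
  (\sum_(k < n) (`[< sat phi (sum_case (fun i => a (k, i)) id) >] : nat)%:R)
    / n%:R.

Definition inst (L : language) (C : structure L) (I J : Type)
    (phi : formula L (I + J)) (b : J -> C) : formula L (I + C) :=
  ren (sum_map id b) phi.

(** [delta p] is a fim measure over M.  The finite subtuple x_0 of x consists of the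
    variables occurring in phi. *)
Definition generically_stable (R : realType) (L : language)
    (C C' M : structure L) (e : elem_emb C C') (j : elem_emb M C) (I : Type)
    (p : set (formula L (I + C))) : Prop :=
  forall (l : nat) (phi : formula L (I + 'I_l)),
  exists theta : forall n : nat, formula L ('I_n * I + M),
    (forall eps : R, 0 < eps ->
       exists N : nat, forall n : nat, (N <= n)%N ->
       forall a : 'I_n * I -> C, sat (theta n) (sum_case a j) ->
         sup [set `|Av R a (inst phi b) - delta R p (inst phi b)|
             | b in [set: 'I_l -> C]] < eps) /\
    (exists N : nat, forall n : nat, (N <= n)%N ->
       morley_pow e j p n (inst (theta n) j)).

Definition diamond (L : language) (C C' M : structure L) (e : elem_emb C C')
    (j : elem_emb M C) (I : Type) (m : I -> M) (p : set (formula L (I + C))) :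
    Prop :=
  forall sigma : aut C', tp e (sigma \o e \o j \o m) = p ->
    invariant_over (sigma @^-1` range (e \o j)) (ext e j p).

(* Main.v *)
(** Say that [a] realizes [p] over [u] if it satisfies all formulas of [p] with
    parameters in [u].

    If [p] is idempotent and [tau m] realizes [p], then the diamond makes
    [tau.(p|C')] an [M]-invariant extension of [p * p = p], hence equal to [p|C'];
    moving [tau m] into [C] over [M] gives an element of [stab p = G_pi], so [p]
    contains [pi]. Conversely, if [p] contains [pi], a realization of [p] over [M] and
    finitely many parameters is the image of [m] under an element of [G_pi = stab p],
    and the same transfer gives [p * p = p].

    For uniqueness let [q] be left [G_pi]-invariant. Generic stability makes [p]
    commute with [q]: there are [a] realizing [p] over [M, b] and [b] realizing [q]
    over [M, a]. Left invariance of [q] and [p] yields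
    [phi(x, m) in q <-> phi(b, a) <-> phi^op(x, m) in p], so the restriction of [q]
    to [M] is the opposite of that of [p]. Applied to [q := p] this shows that the
    restriction of [p] to [M] is its own opposite, so [q] and [p] agree over [M].
    Finally, commutation shows that a Morley sequence of [q] over [M] and a parameter
    [c] is a Morley sequence of [p] over [M], and such a sequence decides membership of
    [phi(x, c)] in [p]; hence [q = p]. *)
From Stdlib Require List.
Require Import Defs.
From mathcomp Require Import all_boot all_order all_algebra.
From mathcomp Require Import all_classical all_reals.
From mathcomp Require Import lra.
Set Implicit Arguments.
Unset Strict Implicit.
Unset Printing Implicit Defensive.
Import Order.TTheory GRing.Theory Num.Theory.
Local Open Scope classical_set_scope.
Local Open Scope card_scope.

(** * Renaming of variables, and free variables of formulas *)

Lemma sum_map_comp (V W V' W' V'' W'' : Type) (f : V -> V') (g : W -> W')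
    (f' : V' -> V'') (g' : W' -> W'') :
  sum_map f' g' \o sum_map f g = sum_map (f' \o f) (g' \o g).
Proof. by apply/funext; case. Qed.

Lemma sum_case_map (V W V' W' X : Type) (f : V -> V') (g : W -> W')
    (f' : V' -> X) (g' : W' -> X) :
  sum_case f' g' \o sum_map f g = sum_case (f' \o f) (g' \o g).
Proof. by apply/funext; case. Qed.

Lemma comp_sum_case (V W X Y : Type) (h : X -> Y) (f : V -> X) (g : W -> X) :
  h \o sum_case f g = sum_case (h \o f) (h \o g).
Proof. by apply/funext; case. Qed.

Section Syntax.
Variable L : language.

Lemma tren_tren (V W X : Type) (f : V -> W) (g : W -> X) (t : term L V) :
  tren g (tren f t) = tren (g \o f) t.
Proof. by elim: t => //= h args IH; congr Defs.Fun; apply/funext => i. Qed.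

Lemma ren_ren (V W X : Type) (f : V -> W) (g : W -> X) (phi : formula L V) :
  ren g (ren f phi) = ren (g \o f) phi.
Proof.
elim: phi W X f g => {V} /=.
- by [].
- by move=> V t u W X f g; rewrite !tren_tren.
- by move=> V r args W X f g; congr FRel; apply/funext => i; rewrite tren_tren.
- by move=> V phi IH1 psi IH2 W X f g; rewrite IH1 IH2.
- by move=> V phi IH W X f g; rewrite IH; congr (FAll (ren _ _)); apply/funext; case.
Qed.

Lemma tren_id (V : Type) (t : term L V) : tren id t = t.
Proof. by elim: t => //= h args IH; congr Defs.Fun; apply/funext => i. Qed.

Lemma ren_id (V : Type) (phi : formula L V) : ren id phi = phi.
Proof.
elim: phi => {V} /=.
- by [].
- by move=> V t u; rewrite !tren_id.
- by move=> V r args; congr FRel; apply/funext => i; rewrite tren_id.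
- by move=> V phi -> psi ->.
- move=> V phi IH; rewrite -{2}IH; congr (FAll (ren _ _)).
  by apply/funext; case.
Qed.

Lemma teval_tren (S : structure L) (V W : Type) (f : V -> W) (t : term L V)
    (v : W -> S) : teval v (tren f t) = teval (v \o f) t.
Proof. by elim: t => //= h args IH; congr fint; apply/funext => i. Qed.

Lemma sat_ren (S : structure L) (V W : Type) (f : V -> W) (phi : formula L V)
    (v : W -> S) : sat (ren f phi) v <-> sat phi (v \o f).
Proof.
elim: phi W f v => {V} /=.
- by [].
- by move=> V t u W f v; rewrite !teval_tren.
- move=> V r args W f v.
  suff -> : (fun i => teval v (tren f (args i))) =
    (fun i => teval (v \o f) (args i)) by [].
  by apply/funext => i; rewrite teval_tren.
- by move=> V phi IH1 psi IH2 W f v; rewrite IH1 IH2.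
- move=> V phi IH W f v; split => H d; have := H d.
  + by rewrite IH; congr (sat _ _); apply/funext; case.
  + by rewrite IH; congr (sat _ _); apply/funext; case.
Qed.

Fixpoint tfv (V : Type) (t : term L V) : set V :=
  match t with
  | Var x => [set x]
  | Defs.Fun g args => \bigcup_i tfv (args i)
  end.

Fixpoint fv (V : Type) (phi : formula L V) : set V :=
  match phi with
  | FFalse => set0
  | FEq t u => tfv t `|` tfv u
  | FRel r args => \bigcup_i tfv (args i)
  | FImp phi psi => fv phi `|` fv psi
  | FAll phi => Some @^-1` fv phi
  end.

Lemma finite_tfv (V : Type) (t : term L V) : finite_set (tfv t).
Proof.
elim: t => /= [x|g args IH]; first exact: finite_set1.
by apply: bigcup_finite => //; exact: finite_finset.
Qed.

(** Variable types may be infinite, but arities are finite. This is what makes the later reductions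
    to finitely many parameters possible. *)
Lemma finite_fv (V : Type) (phi : formula L V) : finite_set (fv phi).
Proof.
elim: phi => {V} /=.
- by move=> V; exact: finite_set0.
- by move=> V t u; rewrite finite_setU; split; exact: finite_tfv.
- move=> V r args; apply: bigcup_finite; first exact: finite_finset.
  by move=> i _; exact: finite_tfv.
- by move=> V phi IH1 psi IH2; rewrite finite_setU.
- move=> V phi IH; apply: card_le_finite IH; apply: card_ge_preimage.
  by move=> x y _ _ [].
Qed.

Lemma finite_fv_inr (V W : Type) (phi : formula L (V + W)) :
  finite_set (inr @^-1` fv phi).
Proof.
apply: card_le_finite (finite_fv phi); apply: card_ge_preimage.
by move=> x y _ _ [].
Qed.

Lemma tren_ext (V W : Type) (f g : V -> W) (t : term L V) :
  (forall x, tfv t x -> f x = g x) -> tren f t = tren g t.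
Proof.
elim: t => /= [x H|h args IH H]; first by rewrite H.
by congr Defs.Fun; apply/funext => i; apply: IH => x Hx; apply: H; exists i.
Qed.

Lemma ren_ext (V W : Type) (f g : V -> W) (phi : formula L V) :
  (forall x, fv phi x -> f x = g x) -> ren f phi = ren g phi.
Proof.
elim: phi W f g => {V} /=.
- by [].
- move=> V t u W f g H; congr FEq; apply: tren_ext => x Hx; apply: H.
  + by left.
  + by right.
- move=> V r args W f g H; congr FRel; apply/funext => i.
  by apply: tren_ext => x Hx; apply: H; exists i.
- move=> V phi IH1 psi IH2 W f g H.
  by rewrite (IH1 _ f g) ?(IH2 _ f g) // => x Hx; apply: H; [right|left].
- move=> V phi IH W f g H; congr FAll; apply: IH; case=> //= x Hx.
  by rewrite H.
Qed.

Lemma teval_ext (S : structure L) (V : Type) (t : term L V) (v w : V -> S) :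
  (forall x, tfv t x -> v x = w x) -> teval v t = teval w t.
Proof.
elim: t => /= [x H|h args IH H]; first by rewrite H.
by congr fint; apply/funext => i; apply: IH => x Hx; apply: H; exists i.
Qed.

Lemma sat_ext (S : structure L) (V : Type) (phi : formula L V) (v w : V -> S) :
  (forall x, fv phi x -> v x = w x) -> sat phi v <-> sat phi w.
Proof.
elim: phi v w => {V} /=.
- by [].
- move=> V t u v w H; rewrite (@teval_ext _ _ t v w) ?(@teval_ext _ _ u v w) //.
  + by move=> x Hx; apply: H; right.
  + by move=> x Hx; apply: H; left.
- move=> V r args v w H.
  suff -> : (fun i => teval v (args i)) = (fun i => teval w (args i)) by [].
  by apply/funext => i; apply: teval_ext => x Hx; apply: H; exists i.
- move=> V phi IH1 psi IH2 v w H.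
  by rewrite (IH1 v w) ?(IH2 v w) // => x Hx; apply: H; [right|left].
- move=> V phi IH v w H; split => H' d; have := H' d; apply: (iffLR (IH _ _ _)).
  + by case=> //= x Hx; apply: H.
  + by case=> //= x Hx; rewrite H.
Qed.

Lemma tfv_tren (V W : Type) (f : V -> W) (t : term L V) :
  tfv (tren f t) = f @` tfv t.
Proof.
elim: t => /= [x|h args IH]; first by rewrite image_set1.
by rewrite image_bigcup; apply: eq_bigcupr => i _.
Qed.

Lemma fv_ren (V W : Type) (f : V -> W) (phi : formula L V) :
  fv (ren f phi) = f @` fv phi.
Proof.
elim: phi W f => {V} /=.
- by move=> V W f; rewrite image_set0.
- by move=> V t u W f; rewrite image_setU !tfv_tren.
- by move=> V r args W f; rewrite image_bigcup; apply: eq_bigcupr => i _; rewrite tfv_tren.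
- by move=> V phi IH1 psi IH2 W f; rewrite image_setU IH1 IH2.
- move=> V phi IH W f; rewrite IH; apply/seteqP; split => [y [[x|]//= Hx [<-]]|_ [x Hx <-]].
  + by exists x.
  + by exists (Some x).
Qed.

End Syntax.

(** * Cardinalities below a strong limit *)

Lemma card_leTP (T U : Type) :
  [set: T] #<= [set: U] <-> exists f : T -> U, injective f.
Proof.
split=> [/card_leP[f]|[f fi]].
  have mT (x : T) : x \in [set: T] by rewrite in_setT.
  exists (fun x => val (f (SigSub (mT x)))) => x y /val_inj.
  by move=> /(@inj _ _ _ f); rewrite !in_setT => /(_ isT isT) [].
have : {in [set: T] &, injective f} by move=> x y _ _; exact: fi.
by move=> /(inj_card_eq) /card_eqPle [_ H]; apply: card_le_trans H (card_leT _).
Qed.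

(** Zorn gives a maximal graph of a partial injection. It cannot miss both an [x] in [T] and a [y]
    in [U], since the pair [(x, y)] could be added. *)
Lemma card_total (T U : Type) : [set: T] #<= [set: U] \/ [set: U] #<= [set: T].
Proof.
pose P := [set G : set (T * U) | forall a b, G a -> G b -> a.1 = b.1 <-> a.2 = b.2].
have [F FP Ftot|G [PG Gmax]] := @Zorn_bigcup _ P.
  move=> a b [X FX Xa] [Y FY Yb].
  by have [XY|YX] := Ftot _ _ FX FY; [apply: (FP _ FY) => //; exact: XY
    |apply: (FP _ FX) => //; exact: YX].
have [[x nx]|ax] := pselect (exists x, ~ exists y, G (x, y)); last first.
  left; apply/card_leTP.
  have tot x : exists y, G (x, y) by apply: contrapT => nx; apply: ax; exists x.
  have [f fG] := choice tot; exists f => x x' e.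
  by have [_ H] := PG _ _ (fG x) (fG x'); exact: H.
right; apply/card_leTP.
have tot y : exists x, G (x, y).
  apply: contrapT => ny; apply: (Gmax (G `|` [set (x, y)])).
    split=> [z Gz|/(_ (x, y))]; first by left.
    by move=> H; apply: nx; exists y; apply: H; right.
  move=> [a1 a2] [b1 b2] [Ga|[-> ->]] [Gb|[-> ->]] //=.
  - exact: (PG _ _ Ga Gb).
  - by split=> e; subst; exfalso; [apply: nx; exists a2|apply: ny; exists a1].
  - by split=> e; subst; exfalso; [apply: nx; exists b2|apply: ny; exists b1].
have [f fG] := choice tot; exists f => y y' e.
by have [H _] := PG _ _ (fG y) (fG y'); exact: H.
Qed.

Definition small (kappa J : Type) : Prop := card_lt [set: J] [set: kappa].

Section Small.
Variable kappa : Type.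
Hypothesis kappa_limit : strong_limit kappa.
Hypothesis kappa_infinite : [set: nat] #<= [set: kappa].

Lemma small_card_le (J : Type) (U : Type) (A : set U) :
  A #<= [set: J] -> small kappa J -> card_lt A [set: kappa].
Proof.
move=> AJ [Jk kJ]; split; first exact: card_le_trans AJ Jk.
by move=> kA; apply: kJ; exact: card_le_trans kA AJ.
Qed.

Lemma small_inj (J K : Type) (f : J -> K) :
  injective f -> small kappa K -> small kappa J.
Proof. by move=> fi; apply: small_card_le; apply/card_leTP; exists f. Qed.

Lemma small_image (J U : Type) (f : J -> U) (A : set J) :
  small kappa J -> card_lt (f @` A) [set: kappa].
Proof.
by apply: small_card_le; apply: card_le_trans (card_image_le _ _) (card_leT _).
Qed.

Lemma small_finite (J : Type) : finite_set [set: J] -> small kappa J.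
Proof.
move=> fJ; split.
  exact: card_le_trans (finite_set_countable fJ) kappa_infinite.
by move=> kJ; move/infiniteP: kappa_infinite; apply; exact: card_le_finite kJ fJ.
Qed.

(** The strong limit property speaks of subsets of [kappa]; an injection of [J] into [kappa]
    transports it to [J]. *)
Lemma small_powerset (J : Type) : small kappa J -> small kappa (set J).
Proof.
move=> Js; have [/card_leTP[f fi] _] := Js.
have [Pk kP] := kappa_limit (small_image f [set: J] Js).
have le : [set: set J] #<= [set X : set kappa | X `<=` f @` [set: J]].
  have /inj_card_eq : {in [set: set J] &, injective (fun X : set J => f @` X)}.
    move=> X Y _ _ e; apply/seteqP; split=> x Xx.
      by have [y Yy /fi <-] : (f @` Y) (f x) by rewrite -e; exists x.
    by have [y Yy /fi <-] : (f @` X) (f x) by rewrite e; exists x.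
  move=> /card_eqPle [_ H]; apply: card_le_trans H _.
  by apply: subset_card_le => _ [X _ <-]; apply: image_subset.
split; first exact: card_le_trans le Pk.
by move=> kX; apply: kP; exact: card_le_trans kX le.
Qed.

(** If [K] is the larger summand and infinite, the sum embeds into the power set of [K]: [J] goes to
    singletons and [K] to complements of singletons, which are never singletons. *)
Lemma small_sum (J K : Type) : small kappa J -> small kappa K ->
  small kappa (J + K)%type.
Proof.
wlog JK : J K / [set: J] #<= [set: K].
  move=> H Js Ks; have [JK|KJ] := card_total J K; first exact: H.
  apply: (@small_inj _ (K + J) (fun z => match z with inl x => inr x | inr x => inl x end)).
    by case=> x [] y // [->].
  exact: H.
move=> _ Ks; have /card_leTP[f fi] := JK.
have [fK|iK] := pselect (finite_set [set: K]).
  apply: small_finite.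
  have -> : [set: (J + K)%type] = inl @` [set: J] `|` inr @` [set: K].
    by apply/seteqP; split=> // -[x|x] _; [left|right]; exists x.
  by rewrite finite_setU; split; apply: finite_image => //; apply: card_le_finite fK.
apply: small_inj (small_powerset Ks).
instantiate (1 := fun z => match z with inl x => [set f x] | inr x => ~` [set x] end).
have ne (x y : K) : [set x] <> ~` [set y].
  move=> e; apply: iK; rewrite -(setvU [set y]) -e finite_setU.
  by split; exact: finite_set1.
have s1 (x y : K) : [set x] = [set y] -> x = y.
  by move=> /seteqP[/(_ x erefl)].
case=> x [] y //=.
- by move=> /s1 /fi ->.
- by move=> /ne.
- by move=> /esym /ne.
- by move=> /(congr1 setC); rewrite !setCK => /s1 ->.
Qed.

Lemma small_copies (J : Type) (n : nat) : small kappa J -> small kappa ('I_n * J)%type.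
Proof.
move=> Js; elim: n => [|n IH].
  apply: small_finite; suff -> : [set: ('I_0 * J)%type] = set0 by exact: finite_set0.
  by apply/seteqP; split => -[[]].
apply: small_inj (small_sum Js IH).
instantiate (1 := @split_last n J).
move=> [a x] [b y]; rewrite /split_last /=.
case: unliftP => [k ->|->]; case: unliftP => [l ->|->] //= [].
  by move=> -> ->.
by move=> ->.
Qed.

End Small.

(** The formulas [x_n = x_n] are pairwise distinct, and [kappa] exceeds the number of formulas. *)
Lemma monster_infinite (L : language) (kappa : Type) (S : structure L) :
  monster kappa S -> [set: nat] #<= [set: kappa].
Proof.
move=> [[h _] _ _ _]; apply: card_le_trans h; apply/card_leTP.
by exists (fun n => FEq (Var n) (Var n)) => x y [].
Qed.

Lemma monster_small_sum (L : language) (kappa J K : Type) (S : structure L) :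
  monster kappa S -> small kappa J -> small kappa K -> small kappa (J + K)%type.
Proof.
move=> hS; apply: small_sum; first exact: monster_strong_limit hS.
exact: monster_infinite hS.
Qed.

Lemma monster_small_finite (L : language) (kappa X : Type) (S : structure L)
    (D : set X) :
  monster kappa S -> finite_set D -> small kappa D.
Proof.
move=> hS fD; apply: (small_finite (monster_infinite hS)).
by apply: card_le_finite fD; case/card_eqPle: (card_setT D).
Qed.

(** * Finite sets as lists, and finite subsets of unions of chains *)

Lemma finite_set_list (T : Type) (A : set T) :
  finite_set A -> exists s : seq T, forall x, A x <-> List.In x s.
Proof.
(* [Peq] equips [T] with a decidable equality, so that [finite_seqP] applies. *)
elim/Peq: T A => T A /finite_seqP[s ->]; exists s => x /=.
elim: s => //= y s IH; rewrite inE; split.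
  by move=> /orP[/eqP ->|/IH]; [left|right].
by move=> [->|/IH]; rewrite ?eqxx// => ->; rewrite orbT.
Qed.

Lemma list_finite_set (T : Type) (s : seq T) : finite_set [set x | List.In x s].
Proof.
elim: s => /= [|y s IH]; first exact: finite_set0.
have -> : [set x | y = x \/ List.In x s] = [set y] `|` [set x | List.In x s].
  by apply/seteqP; split=> x [->|h]; by [left|right].
by rewrite finite_setU; split => //; exact: finite_set1.
Qed.

(** This serves the union step of Zorn below, where a formula involves only finitely many
    variables. *)
Lemma finite_sub_chain (T : Type) (A B : set T) (F : set (set T)) :
  finite_set A -> total_on F subset -> F !=set0 ->
  A `<=` B `|` \bigcup_(X in F) X -> exists2 X, F X & A `<=` B `|` X.
Proof.
move=> /finite_set_list[s As] Ftot [X0 FX0] AF.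
have {AF} : forall x, List.In x s -> (B `|` \bigcup_(X in F) X) x.
  by move=> x /As; exact: AF.
suff H : (forall x, List.In x s -> (B `|` \bigcup_(X in F) X) x) ->
    exists2 X, F X & forall x, List.In x s -> (B `|` X) x.
  by move=> /H[X FX sX]; exists X => // x /As; exact: sX.
elim: s {As} => /= [|y s IH] sF; first by exists X0.
have [|X FX sX] := IH; first by move=> x xs; apply: sF; right.
have [By|[Y FY Yy]] := sF y (or_introl erefl).
  by exists X => // x [<-|/sX//]; left.
have [XY|YX] := Ftot _ _ FX FY.
  exists Y => // x [<-|/sX[]]; first by right.
    by left.
  by move=> /XY; right.
by exists X => // x [<-|/sX//]; right; exact: YX.
Qed.

(** * Automorphisms and elementary embeddings *)

Section Automorphisms.
Variable L : language.

Lemma sat_aut (S : structure L) (sigma : aut S) (V : Type) (phi : formula L V)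
    (v : V -> S) : sat phi (sigma \o v) <-> sat phi v.
Proof.
have [tau sK tK] := aut_bij sigma.
have evE (W : Type) (t : term L W) (w : W -> S) :
    teval (sigma \o w) t = sigma (teval w t).
  elim: t => //= f args IH; rewrite aut_fint; congr fint.
  by apply/funext => i; rewrite IH.
elim: phi v => {V} /=.
- by [].
- by move=> V t u v; rewrite !evE; split=> [/(can_inj sK)|->].
- move=> V r args v; rewrite -(aut_rint sigma (fun i => teval v (args i))).
  suff -> : (fun i => teval (sigma \o v) (args i)) =
    sigma \o (fun i => teval v (args i)) by [].
  by apply/funext => i; rewrite evE.
- by move=> V phi IH1 psi IH2 v; rewrite IH1 IH2.
- move=> V phi IH v.
  have E d : sat phi (fun o => if o is Some x then sigma (v x) else sigma d) <->
      sat phi (fun o => if o is Some x then v x else d).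
    by rewrite -[X in _ <-> X]IH (_ : sigma \o _ = fun o =>
      if o is Some x then sigma (v x) else sigma d)//; apply/funext; case.
  split => H d; first by apply/E; exact: H.
  (* The quantifier step uses surjectivity of [sigma]: the arbitrary [d] is written as an image. *)
  by rewrite -[d]tK; apply/E; exact: H.
Qed.

Lemma aut_inverse (S : structure L) (sigma : aut S) :
  exists tau : aut S, cancel sigma tau /\ cancel tau sigma.
Proof.
have [tau sK tK] := aut_bij sigma.
have Hf (f : Defs.fsym L) (v : 'I_(farity f) -> S) : tau (fint v) = fint (tau \o v).
  apply: (can_inj sK); rewrite tK (aut_fint sigma); congr fint.
  by apply/funext => i /=; rewrite tK.
have Hr (r : rsym L) (v : 'I_(rarity r) -> S) : rint (tau \o v) <-> rint v.
  rewrite -(aut_rint sigma); suff -> : sigma \o (tau \o v) = v by [].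
  by apply/funext => i /=; rewrite tK.
by exists (Defs.Aut (Bijective tK sK) Hf Hr).
Qed.

Lemma aut_comp (S : structure L) (sigma tau : aut S) :
  exists rho : aut S, rho = sigma \o tau :> (S -> S).
Proof.
have b : bijective (sigma \o tau) by apply: bij_comp; exact: aut_bij.
have Hf (f : Defs.fsym L) (v : 'I_(farity f) -> S) :
  (sigma \o tau) (fint v) = fint (sigma \o tau \o v) by rewrite /= !aut_fint.
have Hr (r : rsym L) (v : 'I_(rarity r) -> S) :
  rint (sigma \o tau \o v) <-> rint v.
  by rewrite -(aut_rint tau v) -(aut_rint sigma (tau \o v)).
by exists (Defs.Aut b Hf Hr).
Qed.

Lemma emb_inj (S S' : structure L) (e : elem_emb S S') : injective e.
Proof.
move=> x y exy; pose v b := if b then x else y.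
by have /= := emb_elementary e (FEq (Var true) (Var false)) v; rewrite exy => -[_ ->].
Qed.

Lemma sat_emb (S S' : structure L) (e : elem_emb S S') (V : Type)
    (phi : formula L V) (v : V -> S) : sat phi (e \o v) <-> sat phi v.
Proof. by rewrite -emb_elementary. Qed.

End Automorphisms.

(** The tuples may live in different structures. With [J] of the form [K + M] this expresses
    equality of types over [M]. *)
Definition same_type (L : language) (S S' : structure L) (J : Type)
  (u : J -> S) (u' : J -> S') : Prop :=
  forall phi : formula L J, sat phi u <-> sat phi u'.

Lemma same_type_ren (L : language) (S S' : structure L) (J K : Type)
    (g : K -> J) (u : J -> S) (u' : J -> S') :
  same_type u u' -> same_type (u \o g) (u' \o g).
Proof. by move=> uu' phi; rewrite -(sat_ren g phi u) -(sat_ren g phi u'). Qed.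

(** * Homogeneity and saturation for small tuples *)

Section Monster.
Variables (L : language) (kappa : Type) (S : structure L).
Hypothesis monsterS : monster kappa S.

Lemma homogeneous_tuple (J : Type) (u u' : J -> S) :
  small kappa J -> same_type u u' -> exists sigma : aut S, sigma \o u = u'.
Proof.
move=> Js uu'.
have gP (x : range u) : exists y, u y = val x.
  by case: x => x /=; rewrite inE => -[y _ <-]; exists y.
have [g gE] := choice gP.
have [|sigma sE] := monster_homogeneous monsterS (f := u' \o g) (small_image u setT Js).
  move=> phi; rewrite -(sat_ren g phi u') -uu' sat_ren.
  suff -> : u \o g = set_val by [].
  by apply/funext => x /=; rewrite gE.
exists sigma; apply/funext => x /=.
have ux : u x \in range u by rewrite inE; exists x.
have /= := sE (SigSub ux); rewrite /set_val /= => ->.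
(* [u] need not be injective; but equalities between coordinates belong to the type, so [u'] agrees
   at [x] and at the chosen preimage of [u x]. *)
have /= := uu' (FEq (Var (g (SigSub ux))) (Var x)).
by rewrite gE /= => -[H _]; exact: H.
Qed.

(** Saturation concerns one variable; Zorn extends it to small tuples whose coordinates in [D0] are
    prescribed. Finite satisfiability is tested in another structure [S'], which lets types pass
    between the two monsters. *)
Lemma realize (K : Type) (S' : structure L) (P : set (formula L K)) (D0 : set K)
    (a0 : K -> S) :
  small kappa K ->
  (forall F : set (formula L K), finite_set F -> F `<=` P ->
    exists v : K -> S', forall phi, F phi -> sat phi v) ->
  (forall phi, P phi \/ P (FNot phi)) ->
  (forall phi, P phi -> fv phi `<=` D0 -> sat phi a0) ->
  exists a : K -> S, (forall k, D0 k -> a k = a0 k) /\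
    forall phi, P phi -> sat phi a.
Proof.
move=> Ks finP Pc P0.
pose G0 := [set z : K * S | D0 z.1 /\ z.2 = a0 z.1].
(* Partial assignments are represented by graphs. An admissible one is functional and makes true
   every formula of [P] all of whose variables it assigns. *)
pose ok (H : set (K * S)) := (forall k x y, H (k, x) -> H (k, y) -> x = y) /\
  forall phi a, P phi -> (forall k, fv phi k -> H (k, a k)) -> sat phi a.
have ok0 : ok G0.
  split=> [k x y [_ /= ->] [_ /= ->] //|phi a Pphi Ha].
  have E k : fv phi k -> a k = a0 k by case/Ha.
  rewrite (sat_ext E); apply: P0 => // k /Ha[] //.
(* [G0] is added by hand so that the empty chain is covered and the maximal assignment extends
   [a0]. *)
have [F Fok Ftot|G [okG Gmax]] := @Zorn_bigcup _ [set G | ok (G0 `|` G)].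
  have [F0|F0] := pselect (F !=set0); last first.
    rewrite /= (_ : \bigcup_(X in F) X = set0) ?setU0//.
    by apply/seteqP; split=> // z [X FX _]; apply: F0; exists X.
  split=> [k x y kx ky|phi a Pphi Ha].
    have [X FX H] := finite_sub_chain (finite_set2 (k, x) (k, y)) Ftot F0
      (B := G0) (ltac:(by move=> z [->|->])).
    by have [fX _] := Fok _ FX; apply: fX; apply: H; [left|right].
  have [|X FX H] := finite_sub_chain (finite_image (fun k => (k, a k)) (finite_fv phi))
    Ftot F0 (B := G0); first by move=> _ [k /Ha ? <-].
  by have [_ satX] := Fok _ FX; apply: satX => // k kphi; apply: H; exists k.
move: okG Gmax; set H := G0 `|` G => -[Hfun Hsat] Gmax.
pose dom := [set k | exists x, H (k, x)].
have hP k : exists x, dom k -> H (k, x).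
  have [[x Hx]|nk] := pselect (dom k); first by exists x.
  by have [x] := carrier_inhabited S; exists x.
have [h hE] := choice hP.
(* If the maximal graph missed a variable [k], saturation would provide a value for it. *)
suff domT k : dom k.
  exists h; split=> [k D0k|phi Pphi]; last by apply: Hsat => // k _; exact: hE.
  by apply: Hfun (hE _ (domT k)) _; left.
apply: contrapT => ndk.
pose A := h @` dom.
have hA x (dx : dom x) : h x \in A by rewrite inE; exists x.
(* [r] turns an assigned variable into the parameter that is its value, and any other variable into
   the variable of the 1-type. *)
pose r x : unit + A :=
  match pselect (dom x) with left dx => inr (SigSub (hA x dx)) | right _ => inl tt end.
pose w c x := if `[< dom x >] then h x else c.
have rE c : sum_case (fun=> c) set_val \o r = w c.
  apply/funext => x; rewrite /w /r /=; case: pselect => [dx|ndx] /=.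
    by rewrite asboolT.
  by rewrite asboolF.
pose P1 := [set phi | P phi /\ fv phi `<=` dom `|` [set k]].
have finP1 (s : seq (formula L K)) : (forall phi, List.In phi s -> P1 phi) ->
    exists c, forall phi, List.In phi s -> sat phi (w c).
  (* [psi] says that no value of [k] satisfies all formulas of [s]: [o] keeps the assigned variables
     free and sends [k] to the bound one. *)
  move=> sP1; pose o x := if `[< dom x >] then Some x else None.
  pose psi := FAll (foldr (fun phi acc => FImp (ren o phi) acc) FFalse s).
  have satpsi (S1 : structure L) (v : K -> S1) : sat psi v <->
      forall d, ~ forall phi, List.In phi s ->
        sat phi (fun x => if `[< dom x >] then v x else d).
    rewrite /psi /=; split => vd d; have := vd d.
      elim: s {sP1 psi vd} => /= [//|phi s IH] vd H'; apply: IH => [|chi chis].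
        apply: vd; apply/sat_ren; move: (H' _ (or_introl erefl)).
        congr (sat _ _); apply/funext => x; rewrite /o /=; by case: asboolP.
      by apply: H'; right.
    elim: s {sP1 psi vd} => /= [H'|phi s IH H']; first exact: H'.
    move=> satphi; apply: IH => all_s; apply: H' => chi [<-|]; last exact: all_s.
    move: satphi => /sat_ren; congr (sat _ _); apply/funext => x; rewrite /o /=.
    by case: asboolP.
  have fvpsi : fv psi `<=` dom.
    rewrite /psi /=; elim: s {sP1 psi satpsi} => //= phi s IH x [|/IH//].
    rewrite fv_ren => -[y _]; rewrite /o; by case: asboolP => // dy [<-].
  (* [P] decides [psi]. Membership of [psi] contradicts finite satisfiability in [S']; otherwise the
     negation, whose variables are all assigned, holds at [h] and yields a value. *)
  have [Ppsi|Pnpsi] := Pc psi.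
    have [|v vP] := finP [set phi | List.In phi (psi :: s)] (@list_finite_set _ _).
      by move=> phi /= [<-//|/sP1[]].
    have /satpsi /(_ (v k)) [] := vP psi (or_introl erefl).
    move=> phi phis; have : sat phi v by apply: vP; right.
    apply: (iffLR (sat_ext _)) => x /(proj2 (sP1 _ phis)) xk.
    by case: asboolP => //; case: xk => // ->.
  have : sat (FNot psi) h.
    by apply: Hsat => // x [/fvpsi|[]]; exact: hE.
  move=> /= npsi; apply: contrapT => nc; apply: npsi; apply/satpsi => d satd.
  by apply: nc; exists d.
have [||c cP] := monster_saturated monsterS (A := A) (p := ren r @` P1).
- exact: small_image.
- move=> F /finite_set_list[s Fs] FP1.
  have sP1 phi : exists chi, List.In phi s -> P1 chi /\ ren r chi = phi.
    have [phis|nphi] := pselect (List.In phi s); last by exists FFalse.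
    by have [chi P1chi <-] := FP1 _ (iffRL (Fs _) phis); exists chi.
  have [f fP] := choice sP1.
  have [|c cP] := finP1 (List.map f s).
    by move=> phi /List.in_map_iff[chi [<- /fP[]]].
  exists c => phi /Fs phis; have [_ <-] := fP _ phis.
  by rewrite sat_ren rE; apply: cP; exact: List.in_map.
apply: (Gmax (G `|` [set (k, c)])).
  split=> [z Gz|/(_ (k, c))]; first by left.
  by move=> Gk; apply: ndk; exists c; right; apply: Gk; right.
rewrite /= setUA -/H; split=> [x y z|phi a Pphi Ha].
  move=> [Hy|[xk ->]] [Hz|[xk' ->]] //; first exact: Hfun Hy Hz.
    by exfalso; apply: ndk; rewrite -xk'; exists y.
  by exfalso; apply: ndk; rewrite -xk; exists z.
have : sat (ren r phi) (sum_case (fun=> c) set_val).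
  apply: cP; exists phi => //; split=> // x /Ha[Hx|[-> _]]; last by right.
  by left; exists (a x).
rewrite sat_ren rE; apply: (iffLR (sat_ext _)) => x /Ha; rewrite /w.
case: asboolP => [dx [Hx|[xk _]]|ndx [Hx|[_ ->]]] //.
- exact: Hfun (hE _ dx) Hx.
- by exfalso; apply: ndk; rewrite -xk.
- by exfalso; apply: ndx; exists (a x).
Qed.

End Monster.

(** * Complete types and the action of automorphisms *)

Section Types.
Variables (L : language) (S : structure L) (I : Type).
Implicit Types (p q : set (formula L (I + S))) (sigma tau : aut S).

Lemma complete_consistent p phi :
  complete_type p -> p phi -> p (FNot phi) -> False.
Proof.
move=> [fin _] pphi pnphi.
have [|_ [->|->] //|a aP] := fin [set phi; FNot phi]; first exact: finite_set2.
have : sat (FNot phi) (sum_case a id) by apply: aP; right.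
by apply; apply: aP; left.
Qed.

Lemma complete_typeN p phi : complete_type p -> p (FNot phi) <-> ~ p phi.
Proof.
move=> pc; split=> [pn pphi|npphi]; first exact: complete_consistent pc pphi pn.
by case: pc => _ /(_ phi)[].
Qed.

Lemma complete_type_max p q : complete_type p -> q `<=` p ->
  (forall phi, q phi \/ q (FNot phi)) -> q = p.
Proof.
move=> pc qp qc; apply/seteqP; split=> // phi pphi.
by have [//|/qp/(complete_consistent pc pphi)] := qc phi.
Qed.

Lemma act_inv p sigma tau phi : cancel sigma tau -> cancel tau sigma ->
  act sigma p phi <-> p (ren (sum_map id tau) phi).
Proof.
move=> sK tK; split=> [[chi pchi <-]|pphi].
  rewrite ren_ren sum_map_comp (_ : tau \o sigma = id); last exact/funext.
  by rewrite (_ : sum_map _ _ = id) ?ren_id//; apply/funext; case.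
exists (ren (sum_map id tau) phi) => //.
rewrite ren_ren sum_map_comp (_ : sigma \o tau = id); last exact/funext.
by rewrite (_ : sum_map _ _ = id) ?ren_id//; apply/funext; case.
Qed.

Lemma act_ren p sigma (K : Type) (w : K -> S) (phi : formula L (I + K)) :
  act sigma p (ren (sum_map id (sigma \o w)) phi) <-> p (ren (sum_map id w) phi).
Proof.
have [tau [sK tK]] := aut_inverse sigma.
rewrite (act_inv _ _ sK tK) ren_ren sum_map_comp compA.
by rewrite (_ : tau \o sigma = id)//; exact/funext.
Qed.

Lemma act_comp p sigma tau (rho : aut S) : rho = sigma \o tau :> (S -> S) ->
  act rho p = act sigma (act tau p).
Proof.
move=> rE; rewrite /act image_comp; apply: eq_imagel => phi _ /=.
by rewrite ren_ren sum_map_comp rE.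
Qed.

Lemma invariant_ren p sigma (K : Type) (w : K -> S) (phi : formula L (I + K)) :
  act sigma p = p ->
  p (ren (sum_map id (sigma \o w)) phi) <-> p (ren (sum_map id w) phi).
Proof. by move=> ps; rewrite -[X in X _ <-> _]ps act_ren. Qed.

(** The composite of [sigma] with the inverse of [tau] fixes [A] pointwise, hence preserves [p]. *)
Lemma act_agree (A : set S) p sigma tau : invariant_over A p ->
  (forall a, A a -> sigma a = tau a) -> act sigma p = act tau p.
Proof.
move=> pA st; have [tau' [tK tK']] := aut_inverse tau.
have [rho rE] := aut_comp tau' sigma.
have rp : act rho p = p by apply: pA => a Aa; rewrite rE /= st.
have E : sigma = tau \o rho :> (S -> S) by apply/funext => x; rewrite rE /= tK'.
by rewrite -{2}rp -(act_comp p E).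
Qed.

(** One inclusion suffices, because the automorphisms fixing [A] are closed under inverses. *)
Lemma invariant_overP (A : set S) p :
  (forall sigma, (forall a, A a -> sigma a = a) ->
    forall phi, p phi -> p (ren (sum_map id sigma) phi)) ->
  invariant_over A p.
Proof.
move=> H sigma sA; have [tau [sK tK]] := aut_inverse sigma.
apply/seteqP; split=> [_ [phi pphi <-]|phi pphi]; first exact: H.
by apply/(act_inv _ _ sK tK); apply: H => // a Aa; rewrite -{1}(sA a Aa) sK.
Qed.

Lemma invariant_same_type (kappa : Type) (hS : monster kappa S) (M K : Type)
    (j : M -> S) (p : set (formula L (I + S))) (u u' : K -> S)
    (phi : formula L (I + K)) :
  small kappa M -> small kappa K -> invariant_over (range j) p ->
  same_type (sum_case u j) (sum_case u' j) ->
  p (ren (sum_map id u) phi) <-> p (ren (sum_map id u') phi).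
Proof.
move=> Ms Ks pj uu'.
have KMs := monster_small_sum hS Ks Ms.
have [sigma sE] := homogeneous_tuple hS KMs uu'.
have <- : sigma \o u = u' by apply/funext => x; have := congr1 (@^~ (inl x)) sE.
rewrite invariant_ren//; apply: pj => _ [x _ <-].
by have := congr1 (@^~ (inr x)) sE.
Qed.

End Types.

(** * The invariant extension of a type to the larger monster *)

Section Extension.
Variables (L : language) (kappa kappa' : Type) (C C' M : structure L).
Hypotheses (hC : monster kappa C) (hC' : monster kappa' C').
Variables (e : elem_emb C C') (j : elem_emb M C) (I : Type).
Hypotheses (hMs : small kappa M) (hMs' : small kappa' M) (hIs' : small kappa' I).
Variable p : set (formula L (I + C)).
Hypotheses (pc : complete_type p) (pj : invariant_over (range j) p).

Let cv (phi : formula L (I + C')) : set C' := inr @^-1` fv phi.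

Let finite_cv phi : finite_set (cv phi).
Proof. exact: finite_fv_inr. Qed.

(** [f] is total, but only its values on [D] are tested: there it copies a tuple of [C'] to a tuple
    of [C] with the same type over [M]. *)
Let over_M (f : C' -> C) (D : set C') := forall psi : formula L (C' + M),
  inl @^-1` fv psi `<=` D ->
  sat psi (sum_case id (e \o j)) <-> sat psi (sum_case f j).

Let over_M_sub f (D E : set C') : D `<=` E -> over_M f E -> over_M f D.
Proof. by move=> DE fE psi psiD; apply: fE; exact: subset_trans DE. Qed.

(** The variable type [C' + M] need not be small for [kappa]; this renaming replaces it by [D + M].
    Off [D] the value [x0] is arbitrary. *)
Let shrink (D : set C') (x0 : M) (z : C' + M) : D + M :=
  match z with
  | inl c => match pselect (D c) with
    | left Dc => inl (SigSub (mem_set Dc))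
    | right _ => inr x0
    end
  | inr x => inr x
  end.

(** Saturation of [C] realizes the type over [M] of a finite tuple of [C']; elementarity of [e]
    allows the coordinates in [M] to be prescribed. *)
Let over_M_exists (D : set C') : finite_set D -> exists f, over_M f D.
Proof.
move=> fD; have [x0] := carrier_inhabited M.
have Ds := monster_small_finite hC fD.
have DMs := monster_small_sum hC Ds hMs.
pose v : D + M -> C' := sum_case set_val (e \o j).
have [|||a [aj aP]] := realize (S' := C') (P := [set phi | sat phi v])
  (D0 := range inr) (a0 := sum_case (fun=> j x0) j) hC DMs.
- by move=> F _ FP; exists v.
- by move=> phi; exact: EM.
- move=> phi /= vphi fvphi; apply/(sat_emb e).
  apply: (iffLR (sat_ext _)) vphi => z /fvphi[x _ <-] //.
have aE phi : sat phi a <-> sat phi v.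
  split=> [aphi|/aP//]; apply: contrapT => nv.
  exact: (aP (FNot phi) nv).
exists (fun c => a (shrink D x0 (inl c))) => psi psiD.
rewrite -(@sat_ext _ _ _ psi (v \o shrink D x0)).
  rewrite -(sat_ren (shrink D x0) psi v) -aE sat_ren.
  apply: sat_ext; case=> //= x _; rewrite aj//; exact: imageT.
by move=> [c|x] //= /psiD Dc; rewrite /shrink; case: pselect.
Qed.

Let over_M_tuple (D : set C') f : over_M f D ->
  same_type (sum_case (set_val : D -> C') (e \o j)) (sum_case (f \o set_val) j).
Proof.
move=> fD phi; have := fD (ren (sum_map (set_val : D -> C') id) phi).
rewrite !sat_ren !sum_case_map; apply.
move=> c /=; rewrite fv_ren => -[[d|x] _ //= [<-]].
exact/set_mem/valP.
Qed.

(** By homogeneity an automorphism over [M] carries [f] to [g] on [D], and it preserves [p]. *)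
Let over_M_unique (D : set C') f g (phi : formula L (I + C')) :
  finite_set D -> over_M f D -> over_M g D -> cv phi `<=` D ->
  p (ren (sum_map id f) phi) <-> p (ren (sum_map id g) phi).
Proof.
move=> finD fD gD phiD.
have DMs := monster_small_sum hC
  (monster_small_finite hC finD) hMs.
have fg : same_type (sum_case (f \o (set_val : D -> C')) j) (sum_case (g \o set_val) j).
  by move=> psi; rewrite -(over_M_tuple fD) -(over_M_tuple gD).
have [sigma sE] := homogeneous_tuple hC DMs fg.
have sj x : sigma (j x) = j x by have := congr1 (@^~ (inr x)) sE.
rewrite -(@invariant_ren _ _ _ p sigma _ f); last first.
  by apply: pj => _ [x _ <-].
rewrite (@ren_ext _ _ _ _ (sum_map id g))//.
case=> //= c /phiD Dc; have := congr1 (@^~ (inl (SigSub (mem_set Dc)))) sE.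
by rewrite /= => ->.
Qed.

(** [f] maps the parameters of [phi] to a tuple of [C] with the same type over [M]. *)
Let ext0 : set (formula L (I + C')) :=
  [set phi | exists f, over_M f (cv phi) /\ p (ren (sum_map id f) phi)].

Let ext0E (D : set C') f phi : over_M f D -> cv phi `<=` D ->
  ext0 phi <-> p (ren (sum_map id f) phi).
Proof.
move=> fD phiD; have fphi := over_M_sub phiD fD; split=> [[g [gD pg]]|pf].
  exact/(over_M_unique (finite_cv phi) fphi gD).
by exists f.
Qed.

(** Completeness comes from [p]. For consistency, the formulas with parameters copied by [f] are
    realized in [C] by some [a]; the type of [a] over the copies and [M] is then realized in [C']
    over the original parameters. *)
Let ext0_complete : complete_type ext0.
Proof.
split=> [F /finite_set_list[s Fs] Fext0|phi]; last first.
  have [f fD] := over_M_exists (finite_cv (FNot phi)).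
  have [_ /(_ (ren (sum_map id f) phi))[pphi|pnphi]] := pc.
    by left; apply/(ext0E fD) => // c ?; left.
  by right; apply/(ext0E fD).
pose D := \bigcup_(phi in F) cv phi.
have finF : finite_set F.
  by have -> : F = [set x | List.In x s]; [apply/seteqP; split=> x /Fs|exact: list_finite_set].
have finD : finite_set D by apply: bigcup_finite => // phi _; exact: finite_cv.
have [f fD] := over_M_exists finD.
have phiD phi : F phi -> cv phi `<=` D by move=> Fphi c cphi; exists phi.
have [|_ [phi Fphi <-]|a aP] := pc.1 (ren (sum_map id f) @` F).
- exact: finite_image.
- by apply/(ext0E fD) => //; [exact: phiD|exact: Fext0].
have [x0] := carrier_inhabited M.
have Ds := monster_small_finite hC' finD.
have DMs := monster_small_sum hC' Ds hMs'.
have IDMs := monster_small_sum hC' hIs' DMs.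
pose v : I + (D + M) -> C := sum_case a (sum_case (f \o set_val) j).
pose v' : I + (D + M) -> C' := sum_case (fun=> e (j x0)) (sum_case set_val (e \o j)).
have [|||b [bv' bP]] := realize (S' := C) (P := [set phi | sat phi v])
  (D0 := range inr) (a0 := v') hC' IDMs.
- by move=> F' _ FP; exists v.
- by move=> phi; exact: EM.
- move=> phi /= vphi fvphi.
  pose g (z : I + (D + M)) : D + M := match z with inl _ => inr x0 | inr z => z end.
  have gE (S1 : structure L) (w : I -> S1) (w' : D + M -> S1) :
      sat phi (sum_case w w') <-> sat (ren g phi) w'.
    by rewrite sat_ren; apply: sat_ext => z /fvphi[y _ <-].
  by apply/gE/(over_M_tuple fD); move/gE: vphi.
exists (b \o inl) => phi Fphi.
have := aP _ (ex_intro2 _ _ _ Fphi erefl).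
rewrite sat_ren sum_case_map => aphi.
have : sat (ren (sum_map id (shrink D x0 \o inl)) phi) b.
  apply: bP => /=; rewrite sat_ren; apply: (iffLR (sat_ext _)) aphi.
  case=> //= c /(phiD _ Fphi) Dc; rewrite /v /=.
  by case: pselect.
rewrite sat_ren; apply: (iffLR (sat_ext _)); case=> //= c /(phiD _ Fphi) Dc.
rewrite bv'; last exact: imageT.
by rewrite /v' /=; case: pselect.
Qed.

(** If [f] copies the parameters of [phi], then [f] after the inverse of [sigma] copies the moved
    parameters, and the copied formula is the same. *)
Let ext0_invariant : invariant_over (range (e \o j)) ext0.
Proof.
apply: invariant_overP => sigma sM phi [f [fphi pphi]].
have [tau [sK tK]] := aut_inverse sigma.
exists (f \o tau); split; last first.
  rewrite ren_ren sum_map_comp (_ : f \o tau \o sigma = f)//.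
  by apply/funext => c /=; rewrite sK.
move=> psi psiD.
have := fphi (ren (sum_map tau id) psi); rewrite !sat_ren !sum_case_map => <-.
  rewrite -[X in _ <-> X](sat_aut sigma psi) comp_sum_case.
  rewrite (_ : sigma \o (id \o tau) = id); last exact/funext.
  rewrite (_ : sigma \o (e \o j \o id) = e \o j)//.
  by apply/funext => x /=; apply: sM; exists x.
move=> c /=; rewrite fv_ren => -[[c'|x] psic //= [<-]].
have := psiD _ psic; rewrite /= /cv /= fv_ren => -[[//|c''] phic'' /= [<-]].
by rewrite sK.
Qed.

(** On the range of [e], an inverse of [e] is a copying function by elementarity. *)
Let ext0_restrict : restrict_type e ext0 = p.
Proof.
apply/seteqP.
have [c0] := carrier_inhabited C.
have fP c' : exists c, range e c' -> e c = c'.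
  by have [[c _ ce]|nc] := pselect (range e c'); [exists c|exists c0].
have [f fE] := choice fP.
have fR : over_M f (range e).
  move=> psi psiR; rewrite -(sat_emb e psi) comp_sum_case; apply: sat_ext.
  by case=> //= c /psiR /fE ->.
have fe : f \o e = id by apply/funext => c; apply: (@emb_inj _ _ _ e); apply: fE; exists c.
have E phi : ext0 (ren (sum_map id e) phi) <-> p phi.
  rewrite (ext0E fR) ?ren_ren ?sum_map_comp ?fe.
    by rewrite (_ : sum_map _ _ = id) ?ren_id//; apply/funext; case.
  by move=> c; rewrite /cv /= fv_ren => -[[//|x] _ [<-]]; exists x.
by split=> phi /= /E.
Qed.

(** An automorphism of [C'] over [M] moves the parameters of a formula into the range of [e], where
    [r] is given by [p]. *)
Let ext0_unique (r : set (formula L (I + C'))) :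
  invariant_over (range (e \o j)) r -> restrict_type e r = p -> r = ext0.
Proof.
move=> rM rp; apply/seteqP.
suff E phi : r phi <-> ext0 phi by split=> phi /E.
have [f fphi] := over_M_exists (finite_cv phi).
rewrite (ext0E fphi)// -rp /restrict_type /= ren_ren sum_map_comp.
have Ds := monster_small_finite hC' (finite_cv phi).
have DMs := monster_small_sum hC' Ds hMs'.
have ef : same_type (sum_case (set_val : cv phi -> C') (e \o j))
    (sum_case (e \o f \o set_val) (e \o j)).
  by move=> psi; rewrite (over_M_tuple fphi) -(sat_emb e) comp_sum_case.
have [sigma sE] := homogeneous_tuple hC' DMs ef.
have sj x : sigma (e (j x)) = e (j x) by have := congr1 (@^~ (inr x)) sE.
have rs : act sigma r = r by apply: rM => _ [x _ <-]; exact: sj.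
have := @invariant_ren _ _ _ r sigma _ id phi rs.
rewrite (_ : sum_map id id = id) ?ren_id; last by apply/funext; case.
move=> <-.
rewrite (@ren_ext _ _ _ _ (sum_map id (e \o f)))//.
by case=> //= c Dc; have /= -> := congr1 (@^~ (inl (SigSub (mem_set (Dc : cv phi c))))) sE.
Qed.

Let ext_ext0 : ext e j p = ext0.
Proof.
apply/seteqP; split=> [phi [r [_ rM rp rphi]]|phi phi0].
  by rewrite -(ext0_unique rM rp).
by exists ext0; split.
Qed.

Lemma ext_complete : complete_type (ext e j p).
Proof. by rewrite ext_ext0. Qed.

Lemma ext_invariant : invariant_over (range (e \o j)) (ext e j p).
Proof. by rewrite ext_ext0. Qed.

Lemma ext_restrict : restrict_type e (ext e j p) = p.
Proof. by rewrite ext_ext0. Qed.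

Lemma ext_unique (r : set (formula L (I + C'))) :
  invariant_over (range (e \o j)) r -> restrict_type e r = p -> r = ext e j p.
Proof. by move=> rM rp; rewrite ext_ext0; exact: ext0_unique. Qed.

Lemma ext_ren (K : Type) (w : K -> C) (phi : formula L (I + K)) :
  ext e j p (ren (sum_map id (e \o w)) phi) <-> p (ren (sum_map id w) phi).
Proof.
rewrite -[X in _ <-> X _]ext_restrict /restrict_type /= ren_ren sum_map_comp.
by rewrite (_ : id \o id = id).
Qed.

Lemma ext_same_type (K : Type) (u : K -> C') (w : K -> C) (phi : formula L (I + K)) :
  small kappa' K -> same_type (sum_case u (e \o j)) (sum_case w j) ->
  ext e j p (ren (sum_map id u) phi) <-> p (ren (sum_map id w) phi).
Proof.
move=> Ks uw; rewrite -ext_ren; apply: (invariant_same_type hC' phi hMs' Ks ext_invariant).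
by move=> psi; rewrite uw -(sat_emb e) comp_sum_case.
Qed.

End Extension.

(** * Realizing types over small tuples *)

Lemma finite_retract (X : Type) (D : set X) : finite_set D ->
  exists (n : nat) (g : X -> 'I_n) (b : 'I_n -> X), forall x, D x -> b (g x) = x.
Proof.
move=> /finite_set_list[s Ds].
have [[x0]|nX] := pselect (inhabited X); last first.
  have absX (x : X) : False by apply: nX; exact: (inhabits x).
  exists 0, (fun x => match absX x with end).
  by exists (fun i : 'I_0 => match notF (ltn_ord i) with end) => x; case: (absX x).
(* The additional index guarantees a value for points outside [D], even if the list is empty. *)
have sP x : exists i : 'I_(size s).+1, D x -> nth x0 s i = x.
  have [Dx|] := pselect (D x); last by exists ord0.
  move/Ds: (Dx); elim: s {Ds} => //= y s IH [->|/IH[i iE]]; first by exists ord0.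
  by exists (lift ord0 i) => _ /=; exact: iE.
have [g gE] := choice sP.
by exists (size s).+1, g, (fun i => nth x0 s i).
Qed.

(** This brings an arbitrary formula into the form with a finite parameter tuple that
    [generically_stable] tests, and makes its parameters small. *)
Lemma finite_parameters (L : language) (V X : Type) (phi : formula L (V + X)) :
  exists (n : nat) (g : X -> 'I_n) (b : 'I_n -> X),
    ren (sum_map id b) (ren (sum_map id g) phi) = phi.
Proof.
have [n [g [b bg]]] := finite_retract (finite_fv_inr phi).
exists n, g, b; rewrite ren_ren sum_map_comp -[RHS]ren_id; apply: ren_ext.
by case=> //= x /bg ->.
Qed.

Definition realizes (L : language) (S : structure L) (I K : Type)
    (p : set (formula L (I + S))) (u : K -> S) (a : I -> S) : Prop :=
  forall phi : formula L (I + K),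
    p (ren (sum_map id u) phi) -> sat phi (sum_case a u).

Section Realize.
Variables (L : language) (S : structure L) (I : Type).
Implicit Types (p : set (formula L (I + S))).

Lemma realizeE (K : Type) p (u : K -> S) (a : I -> S) (phi : formula L (I + K)) :
  complete_type p -> realizes p u a ->
  p (ren (sum_map id u) phi) <-> sat phi (sum_case a u).
Proof.
move=> pc ua; split=> [/ua//|aphi]; apply: contrapT => /(complete_typeN _ pc).
by move=> /(ua (FNot phi)); apply.
Qed.

Lemma realizes_comp (J K : Type) p (u : K -> S) (g : J -> K) (a : I -> S) :
  realizes p u a -> realizes p (u \o g) a.
Proof.
move=> ua phi pphi; have := ua (ren (sum_map id g) phi).
by rewrite ren_ren sum_map_comp sat_ren sum_case_map; exact.
Qed.

(** Finite parts of the type are realized in [S] over [u]; [realize] then works in [S'] with the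
    coordinates of [u] prescribed as [e \o u]. *)
Lemma realize_type (kappa : Type) (S' : structure L) (hS' : monster kappa S')
    (e : elem_emb S S') (K : Type) p (u : K -> S) :
  small kappa I -> small kappa K -> complete_type p ->
  exists a : I -> S', forall phi : formula L (I + K),
    p (ren (sum_map id u) phi) -> sat phi (sum_case a (e \o u)).
Proof.
move=> Is Ks [pfin pc].
have IKs := monster_small_sum hS' Is Ks.
have [x0] := carrier_inhabited S'.
have fin (F : set (formula L (I + K))) : finite_set F ->
    (forall phi, F phi -> p (ren (sum_map id u) phi)) ->
    exists a : I -> S, forall phi, F phi -> sat phi (sum_case a u).
  move=> finF Fp; have [||a aP] := pfin (ren (sum_map id u) @` F).
  - exact: finite_image.
  - by move=> _ [phi /Fp ? <-].
  exists a => phi Fphi; have := aP _ (ex_intro2 _ _ _ Fphi erefl).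
  by rewrite sat_ren sum_case_map.
have [|||b [bu bP]] := @realize L kappa S' hS' (I + K)%type S
  [set phi | p (ren (sum_map id u) phi)] (range inr) (sum_case (fun=> x0) (e \o u)) IKs.
- move=> F finF /(fin _ finF)[a aP]; by exists (sum_case a u).
- by move=> phi; exact: pc.
- move=> phi pphi fvphi; have [||a aP] := fin [set phi]; first exact: finite_set1.
    by move=> _ ->.
  have := aP _ erefl; rewrite -(sat_emb e); apply: (iffLR (sat_ext _)).
  by move=> z /fvphi[y _ <-].
exists (b \o inl) => phi /bP; congr (sat _ _); apply/funext; case=> //= x.
by rewrite bu//; exists x.
Qed.

Lemma realizes_exists (kappa : Type) (hS : monster kappa S) (K : Type) p (u : K -> S) :
  small kappa I -> small kappa K -> complete_type p -> exists a, realizes p u a.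
Proof.
have idE (V : Type) (phi : formula L V) (v : V -> S) : sat phi v <-> sat phi (id \o v) by [].
move=> Is Ks pc; exact: (realize_type hS (ElemEmb idE) u Is Ks pc).
Qed.

Variables (kappa : Type) (hS : monster kappa S) (M : Type) (j : M -> S).
Hypotheses (Ms : small kappa M).

(** The map [g] locates [M] inside both tuples, so equality of their types is already equality over
    [M]. *)
Lemma invariant_same_type_over (K : Type) p (g : M -> K) (u u' : K -> S)
    (phi : formula L (I + K)) :
  small kappa K -> invariant_over (range j) p -> u \o g = j -> u' \o g = j ->
  same_type u u' -> p (ren (sum_map id u) phi) <-> p (ren (sum_map id u') phi).
Proof.
move=> Ks pj ug u'g uu'; apply: (invariant_same_type hS phi Ms Ks pj).
have E (v : K -> S) : v \o g = j -> sum_case v j = v \o sum_case id g.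
  by move=> <-; rewrite comp_sum_case.
by rewrite !E//; exact: same_type_ren.
Qed.

Lemma realizes_same_type (K : Type) p (g : M -> K) (u u' : K -> S) (a a' : I -> S) :
  small kappa K -> complete_type p -> invariant_over (range j) p ->
  u \o g = j -> u' \o g = j -> same_type u u' ->
  realizes p u a -> realizes p u' a' ->
  same_type (sum_case a u) (sum_case a' u').
Proof.
move=> Ks pc pj ug u'g uu' ua ua' phi.
rewrite -(realizeE _ pc ua) -(realizeE _ pc ua').
exact: (invariant_same_type_over phi Ks pj ug u'g).
Qed.

End Realize.
Arguments realizes_comp {L S I J K p u} g {a} _.

(** * Morley sequences and commutation of types *)

Definition initial (S K I : Type) (u : K -> S) (a : nat -> I -> S) (n : nat) :
    'I_n * I + K -> S :=
  sum_case (fun z : 'I_n * I => a z.1 z.2) u.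
Arguments initial {S K I} u a n.

Definition unsnoc (n : nat) (I K : Type) (z : 'I_n.+1 * I + K) : I + ('I_n * I + K) :=
  match z with
  | inl y => match split_last y with inl i => inl i | inr y => inr (inl y) end
  | inr x => inr (inr x)
  end.

Lemma initialS (S K I : Type) (u : K -> S) (a : nat -> I -> S) (n : nat) :
  initial u a n.+1 = sum_case (a n) (initial u a n) \o (@unsnoc n I K).
Proof.
apply/funext => -[[k i]|x] //=; rewrite /split_last /=.
by case: unliftP => [l ->|->] //=; rewrite /bump leqNgt ltn_ord.
Qed.

(** Later members realize [p] over earlier ones, as in [morley_pow]; members from index [n] on are
    arbitrary. *)
Definition morley (L : language) (S : structure L) (I K : Type)
    (p : set (formula L (I + S))) (u : K -> S) (a : nat -> I -> S) (n : nat) : Prop :=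
  forall k, (k < n)%N -> realizes p (initial u a k) (a k).

Section Morley.
Variables (L : language) (kappa : Type) (S : structure L) (I : Type).
Hypotheses (hS : monster kappa S) (Is : small kappa I).
Variables (M : Type) (j : M -> S).
Hypothesis Ms : small kappa M.
Implicit Types (p q : set (formula L (I + S))).

Let small_initial (K : Type) (n : nat) :
  small kappa K -> small kappa ('I_n * I + K)%type.
Proof.
move=> Ks; apply: (monster_small_sum hS _ Ks); apply: small_copies => //.
  exact: monster_strong_limit hS.
exact: monster_infinite hS.
Qed.

Lemma morley_comp (J K : Type) p (u : K -> S) (g : J -> K) a n :
  morley p u a n -> morley p (u \o g) a n.
Proof.
move=> ua k /ua /(realizes_comp (sum_map id g)).
by rewrite /initial sum_case_map.
Qed.

Arguments morley_comp {J K p u} g {a n} _.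

Lemma morley_realizes (K : Type) p (u : K -> S) a n k :
  morley p u a n -> (k < n)%N -> realizes p u (a k).
Proof. by move=> ua /ua /(realizes_comp inr). Qed.

Lemma morley_exists (K : Type) p (u : K -> S) (n : nat) :
  small kappa K -> complete_type p -> exists a, morley p u a n.
Proof.
move=> Ks pc; elim: n => [|n [a ua]].
  by have [c] := carrier_inhabited S; exists (fun _ _ => c).
have [x ux] := realizes_exists hS (initial u a n) Is (small_initial n Ks) pc.
pose a' k := if k == n then x else a k.
have pE k : (k <= n)%N -> initial u a' k = initial u a k.
  move=> kn; apply/funext => -[[l i]|//] /=; rewrite /a' ltn_eqF//.
  exact: leq_trans (ltn_ord l) kn.
exists a' => k; rewrite ltnS => kn; rewrite pE//.
move: kn; rewrite leq_eqVlt /a' => /predU1P[->|kn]; first by rewrite eqxx.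
by rewrite ltn_eqF//; exact: ua.
Qed.

(** The formulas [theta_n] of generic stability matter only through their truth on
    Morley sequences of [p]. *)
Definition stably_tested p := forall (K : Type) (phi : formula L (I + K)),
  exists n, forall a, morley p j a n -> forall w : K -> S,
    (forall k, (k < n)%N -> sat phi (sum_case (a k) w)) ->
    p (ren (sum_map id w) phi).

(** Suppose [phi(x, b, u)] is in [p] but fails at [a]. Take a Morley sequence [a'] of [p] over [u]
    and [b'] realizing [q] over [u] and [a']. Invariance of [q] makes [phi(a'_k, b', u)] fail for
    all [k], so testing puts its negation at [b'] into [p]. As [b'] and [b] have the same type over
    [u], the negation at [b] is in [p] too. *)
Lemma realizes_commute (K : Type) p q (g : M -> K) (u : K -> S) a b :
  small kappa K -> u \o g = j ->
  complete_type p -> invariant_over (range j) p -> stably_tested p ->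
  complete_type q -> invariant_over (range j) q ->
  realizes p u a -> realizes q (sum_case a u) b -> realizes p (sum_case b u) a.
Proof.
move=> Ks ug pc pj pst qc qj ua uab phi pphi; apply: contrapT => naphi.
have [n nP] := pst _ (FNot phi).
have [a' ua'] := morley_exists u n Ks pc.
have [b' ub'] := realizes_exists hS (initial u a' n) Is (small_initial n Ks) qc.
pose swap (z : I + (I + K)) : I + (I + K) :=
  match z with
  | inl x => inr (inl x) | inr (inl x) => inl x | inr (inr y) => inr (inr y)
  end.
have swapE (x y : I -> S) : sat (ren swap phi) (sum_case x (sum_case y u)) <->
    sat phi (sum_case y (sum_case x u)).
  rewrite sat_ren; suff -> : sum_case x (sum_case y u) \o swap =
    sum_case y (sum_case x u) by [].
  by apply/funext; case=> // -[].
have bb' : same_type (sum_case b' u) (sum_case b u).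
  apply: (realizes_same_type hS Ms Ks qc qj ug ug) => //.
    exact: (realizes_comp inr ub').
  exact: (realizes_comp inr uab).
have IKs := monster_small_sum hS Is Ks.
have : p (ren (sum_map id (sum_case b' u)) (FNot phi)).
  apply: nP => [|k kn]; first by rewrite -ug; exact: (morley_comp g ua').
  have aa' : same_type (sum_case (a' k) u) (sum_case a u).
    apply: (realizes_same_type hS Ms Ks pc pj ug ug) => //.
    exact: morley_realizes ua' kn.
  move=> bphi; apply: naphi; apply/swapE; apply/(realizeE _ qc uab).
  have := @invariant_same_type_over _ _ _ _ hS _ j Ms (I + K)%type q (inr \o g)
    _ _ (ren swap phi) IKs qj ug ug aa'.
  move=> <-; apply: contrapT => /(complete_typeN _ qc) H.
  have ukb' : realizes q (sum_case (a' k) u) b'.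
    have := realizes_comp (sum_map (fun x => (Ordinal kn, x)) id) ub'.
    by rewrite /initial sum_case_map.
  by apply: (ukb' (FNot (ren swap phi)) H); apply/swapE.
have := @invariant_same_type_over _ _ _ _ hS _ j Ms (I + K)%type p (inr \o g)
    _ _ (FNot phi) IKs pj ug ug bb'.
by move=> -> /(complete_consistent pc pphi).
Qed.

Lemma invariant_extension_unique p q :
  complete_type p -> invariant_over (range j) p -> stably_tested p ->
  complete_type q -> invariant_over (range j) q ->
  (forall phi : formula L (I + M),
    q (ren (sum_map id j) phi) -> p (ren (sum_map id j) phi)) ->
  q = p.
Proof.
move=> pc pj pst qc qj qp; apply: complete_type_max => // [phi qphi|]; last by case: qc.
have [l [g [w phiE]]] := finite_parameters phi.
pose phi0 := ren (sum_map id g) phi.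
have [n nP] := pst _ phi0.
have ls : small kappa 'I_l.
  by apply: (small_finite (monster_infinite hS)); exact: finite_finset.
(* The sequence is taken over [w] as well as [M], so that its members satisfy the given formula;
   only over [M] is it shown to be Morley for [p]. *)
have [b ub] := morley_exists (sum_case w j) n (monster_small_sum hS ls Ms) qc.
have jb : morley q j b n by exact: (morley_comp inr ub).
rewrite -phiE; apply: (nP b); last first.
  move=> k kn; have := morley_realizes ub kn; move=> /(realizes_comp inl); apply.
  by rewrite /= (_ : sum_case w j \o inl = w)// phiE.
suff H k : (k <= n)%N -> morley p j b k by exact: H.
elim: k => // k IH kn; have {IH}pk : morley p j b k by apply: IH; exact: ltnW.
move=> i; rewrite ltnS leq_eqVlt => /predU1P[->|]; last exact: pk.
have ubk := jb k kn.
(* [b'] is a true realization of [p] over the first [k] members, to which [b k] is compared. *)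
have [b' ub'] := realizes_exists hS (initial j b k) Is (small_initial k Ms) pc.
have comm (r : set (formula L (I + S))) c : complete_type r -> invariant_over (range j) r ->
    realizes r (initial j b k) c -> forall i, (i < k)%N ->
    realizes p (sum_case c (initial j b i)) (b i).
  move=> rc rj uc i' ik.
  apply: (@realizes_commute _ p r inr (initial j b i') (b i') c
    (small_initial i' Ms) erefl pc pj pst rc rj (pk _ ik)).
  pose h (z : I + ('I_i' * I + M)) : 'I_k * I + M :=
    match z with
    | inl x => inl (Ordinal ik, x)
    | inr (inl y) => inl (widen_ord (ltnW ik) y.1, y.2)
    | inr (inr x) => inr x
    end.
  have := realizes_comp h uc; congr (realizes _ _ _).
  by apply/funext; case=> // -[].
(* Members are added to the parameters one at a time. By [comm], [b i'] realizes [p] over the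
   earlier members together with [b k], and likewise with [b']; so equality of types passes on. At
   the start it is the agreement of [q] and [p] over [M]. *)
have same i' : (i' <= k)%N ->
    same_type (sum_case (b k) (initial j b i')) (sum_case b' (initial j b i')).
  elim: i' => [_|i' IH ik].
    pose h (z : I + ('I_0 * I + M)) : I + M :=
      match z with
      | inl x => inl x
      | inr (inl y) => match notF (ltn_ord y.1) with end
      | inr (inr x) => inr x
      end.
    have E (c : I -> S) : sum_case c (initial j b 0) = sum_case c j \o h.
      by apply/funext; case=> // -[[[]]|].
    rewrite !E; apply: same_type_ren.
    apply: (realizes_same_type hS Ms Ms pc pj (g := id)) => //.
      move=> chi; have := realizes_comp inr ubk; rewrite /initial => jbk.
      move=> pchi; apply/(realizeE _ qc jbk); apply: contrapT => /(complete_typeN _ qc).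
      move=> /(qp (FNot chi)); exact: complete_consistent pc pchi.
    exact: (realizes_comp inr ub').
  have {}IH := IH (ltnW ik).
  pose h (z : I + ('I_i'.+1 * I + M)) : I + (I + ('I_i' * I + M)) :=
    match z with
    | inl x => inr (inl x)
    | inr y => match unsnoc y with inl x => inl x | inr y => inr (inr y) end
    end.
  have E (c : I -> S) : sum_case c (initial j b i'.+1) =
      sum_case (b i') (sum_case c (initial j b i')) \o h.
    rewrite initialS; apply/funext; case=> //= y.
    by case: (unsnoc y).
  rewrite !E; apply: same_type_ren.
  apply: (realizes_same_type hS Ms _ pc pj (g := inr \o inr)) => //.
  - by apply: (monster_small_sum hS) => //; exact: small_initial.
  - exact: comm ubk _ ik.
  - exact: comm ub' _ ik.
move=> chi pchi; apply/(same k (leqnn k)); exact: ub'.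
Qed.

End Morley.

(** * Morley powers and generic stability *)

Section MorleyPower.
Variables (L : language) (kappa kappa' : Type) (C C' M : structure L).
Hypotheses (hC : monster kappa C) (hC' : monster kappa' C').
Variables (e : elem_emb C C') (j : elem_emb M C) (I : Type).
Hypotheses (Ms : small kappa M) (Ms' : small kappa' M) (Is' : small kappa' I).
Variable p : set (formula L (I + C)).
Hypotheses (pc : complete_type p) (pj : invariant_over (range j) p).

Lemma morley_pow_sat (n : nat) (a : nat -> I -> C) (phi : formula L ('I_n * I + M)) :
  morley p j a n -> morley_pow e j p n (ren (sum_map id j) phi) ->
  sat phi (initial j a n).
Proof.
elim: n phi => [phi _ [a0]|n IH phi ja [b [bE0]]].
  rewrite sat_ren sum_case_map (_ : a0 \o id = fun z => a z.1 z.2)//.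
  by apply/funext => -[[]].
have bE : tp e b = morley_pow e j p n := bE0.
(* The realization [b] of the power lies in [C'], the sequence [a] in [C]. The induction hypothesis,
   applied also to negations, equates their types over [M], so [ext] at [b] can be read as [p] at
   [a]. *)
have {}IH : same_type (sum_case b (e \o j)) (initial j a n).
  move=> chi; have E : sat chi (sum_case b (e \o j)) <->
      morley_pow e j p n (ren (sum_map id j) chi).
    by rewrite -bE /tp /= sat_ren sum_case_map.
  have jan : morley p j a n by move=> k kn; apply: ja; exact: ltnW.
  split=> [/E/IH|aphi]; first exact.
  apply: contrapT => nb; have := IH (FNot chi) jan.
  apply=> //; rewrite -bE /tp /= => H; apply: nb.
  by move: H; rewrite sat_ren sum_case_map.
rewrite !ren_ren.
have -> : sum_case (sum_map id b) (inr \o e) \o sum_map (@split_last n I) id \o sum_map id j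
    = sum_map id (sum_case b (e \o j)) \o (@unsnoc n I M).
  apply/funext => -[z|x] //=; rewrite /unsnoc /=.
  by case: (split_last z).
rewrite -ren_ren => H.
have : p (ren (sum_map id (initial j a n)) (ren (@unsnoc n I M) phi)).
  apply/(ext_same_type hC hC' Ms Ms' Is' pc pj (e := e) (u := sum_case b (e \o j))) => //.
    apply: (monster_small_sum hC' _ Ms'); apply: small_copies => //.
      exact: monster_strong_limit hC'.
    exact: monster_infinite hC'.
  have E (S : Type) (v : 'I_n * I -> S) (w : M -> S) :
    sum_case (sum_case v w) w = sum_case v w \o sum_case id inr.
    by rewrite comp_sum_case.
  by rewrite /initial !E; exact: (@same_type_ren _ _ _ _ _ (sum_case id inr) _ _ IH).
move=> /(ja n (ltnSn n)); by rewrite sat_ren -initialS.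
Qed.

(** Take error 1. If all members satisfy [phi] but [phi] is not in [p], the average is 1 and [delta]
    is 0, so the supremum is at least 1. *)
Lemma generically_stable_tested (R : realType) :
  generically_stable R e j p -> stably_tested j p.
Proof.
move=> gs K phi.
have [l [g [b phiE]]] := finite_parameters phi.
have [theta [thetaAv [N2 thetap]]] := gs l (ren (sum_map id g) phi).
have [N1 N1P] := thetaAv 1%R ltr01.
(* The sequence must be nonempty, since its average divides by [n]. *)
pose n := maxn 1 (maxn N1 N2); exists n => a ja w aw; apply: contrapT => npw.
have := thetap n; rewrite !leq_max leqnn !orbT => /(_ isT).
move=> /(morley_pow_sat ja) satn.
have := N1P n; rewrite !leq_max leqnn !orbT => /(_ isT _ satn).
set A := [set _ | _ in _]; apply/negP; rewrite -leNgt.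
have instE : inst (ren (sum_map id g) phi) (w \o b) = ren (sum_map id w) phi.
  by rewrite -[in RHS]phiE /inst (ren_ren (sum_map id b)) sum_map_comp.
have ngt0 : (0 < n%:R :> R)%R by rewrite ltr0n leq_max.
have Av1 (psi : formula L (I + C)) (c : 'I_n * I -> C) : (0 <= Av R c psi <= 1)%R.
  rewrite /Av divr_ge0//=; last exact: sumr_ge0.
  rewrite ler_pdivrMr// mul1r -[X in (_ <= X%:R)%R]card_ord -sum1_card natr_sum.
  by apply: ler_sum => k _; rewrite ler_nat leq_b1.
have A1 : A 1%R.
  exists (w \o b) => //; rewrite instE /delta asboolF// subr0 /Av.
  rewrite (eq_bigr (fun=> 1%R)) => [|k _]; last first.
    rewrite asboolT// sat_ren sum_case_map; exact: (aw k (ltn_ord k)).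
  by rewrite sumr_const card_ord divff ?normr1// lt0r_neq0.
(* The supremum dominates its members only for a set bounded above; 2 is a crude bound. *)
apply: (ub_le_sup _ A1); exists 2%R => _ [c _ <-].
have /andP[Av0 Avle] := Av1 (inst (ren (sum_map id g) phi) c) (fun z => a z.1 z.2).
rewrite ler_norml /delta; case: asboolP => _ /=; apply/andP; split; lra.
Qed.

End MorleyPower.

(** Conjugating by [tau] an automorphism that fixes [A] gives one that fixes the preimage of [A].
    This is how the diamond is used. *)
Lemma invariant_act (L : language) (S : structure L) (I : Type) (A : set S)
    (p : set (formula L (I + S))) (tau : aut S) :
  invariant_over (tau @^-1` A) p -> invariant_over A (act tau p).
Proof.
move=> pA sigma sA; have [tau' [tK tK']] := aut_inverse tau.
have [st stE] := aut_comp sigma tau; have [ka kaE] := aut_comp tau' st.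
have E : st = tau \o ka :> (S -> S) by apply/funext => x; rewrite kaE /= tK'.
rewrite -(act_comp p stE) (act_comp p E) (pA ka)// => a Aa.
by rewrite kaE /= stE /= sA.
Qed.

Lemma act_complete (L : language) (S : structure L) (I : Type)
    (p : set (formula L (I + S))) (tau : aut S) (phi : formula L (I + S)) :
  complete_type p -> act tau p phi \/ act tau p (FNot phi).
Proof.
move=> [_ pc]; have [tau' [tK tK']] := aut_inverse tau.
have [pphi|pnphi] := pc (ren (sum_map id tau') phi); [left|right].
  exact/(act_inv _ _ tK tK').
exact/(act_inv _ (FNot phi) tK tK').
Qed.

(** * Types of the enumeration of [M], and the stabilizer of [p] *)

Section EnumeratedModel.
Variables (L : language) (kappa kappa' : Type) (C C' M : structure L).
Hypotheses (hC : monster kappa C) (hC' : monster kappa' C').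
Variables (e : elem_emb C C') (j : elem_emb M C) (I : Type) (m : I -> M).
Hypotheses (Cs' : small kappa' C) (Ms : small kappa M) (m_bij : bijective m).
Implicit Types (p q : set (formula L (I + C))).

Let Is : small kappa I.
Proof. exact: small_inj (bij_inj m_bij) Ms. Qed.

Let Ms' : small kappa' M.
Proof. exact: small_inj (@emb_inj _ _ _ j) Cs'. Qed.

Let Is' : small kappa' I.
Proof. exact: small_inj (bij_inj m_bij) Ms'. Qed.

(** [C] itself is a small tuple for [C'], so homogeneity of [C'] applies to all of it. *)
Lemma aut_extends (sigma : aut C) : exists tau : aut C', tau \o e = e \o sigma.
Proof.
apply: (homogeneous_tuple hC' Cs') => phi.
by rewrite -[emb_fun e]/(e \o id) !sat_emb -(sat_aut sigma phi id).
Qed.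

Lemma Sinv_same_type (K : Type) p (u : K -> C) (a : I -> C) :
  Sinv j m p -> realizes p u a -> same_type (j \o m) a.
Proof.
move=> [_ ptp _] ua.
have H phi : sat phi (j \o m) -> sat phi a.
  move=> /ptp pphi; have := ua (ren inl phi); rewrite ren_ren sat_ren; exact.
move=> phi; split=> [/H//|aphi]; apply: contrapT => njphi.
exact: (H (FNot phi)).
Qed.

Lemma tp_realized p : Sinv j m p ->
  exists tau : aut C', tp e (tau \o e \o j \o m) = p.
Proof.
move=> [pc ptp _].
have [b bP] := realize_type hC' e id Is' Cs' pc.
have sum_id : sum_map id id = id :> (I + C -> I + C) by apply/funext; case.
have tpb : tp e b = p.
  apply: complete_type_max => // [phi bphi|phi]; last exact: EM.
  apply: contrapT => /(complete_typeN _ pc) pn.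
  by have := bP (FNot phi); rewrite sum_id ren_id => /(_ pn); apply.
have jb : same_type (e \o (j \o m)) b.
  have H phi : sat phi (j \o m) -> sat phi b.
    by move=> /ptp; rewrite -tpb /tp /= sat_ren.
  move=> phi; rewrite sat_emb; split=> [/H//|bphi]; apply: contrapT => njphi.
  exact: (H (FNot phi)).
have [tau tauE] := homogeneous_tuple hC' Is' jb.
by exists tau; rewrite -tpb -tauE.
Qed.

Section ActExt.
Variable p : set (formula L (I + C)).
Hypothesis hp : Sinv j m p.

Let pc : complete_type p. Proof. by case: hp. Qed.
Let pj : invariant_over (range j) p. Proof. by case: hp. Qed.
Let ext_j := ext_invariant hC hC' (e := e) Ms Ms' Is' pc pj.
Let ext_p := ext_restrict hC hC' e Ms Ms' Is' pc pj.

Lemma act_ext_restrict (sigma : aut C) (tau : aut C') : tau \o e = e \o sigma ->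
  restrict_type e (act tau (ext e j p)) = act sigma p.
Proof.
move=> te; have [s [sK Ks]] := aut_inverse sigma.
suff E phi : act tau (ext e j p) (ren (sum_map id e) phi) <-> act sigma p phi.
  by apply/seteqP; split=> phi /E.
rewrite (act_inv _ _ sK Ks) -[in X in _ <-> X]ext_p /restrict_type /=.
rewrite -[X in _ <-> X](act_ren _ tau) te ren_ren sum_map_comp.
rewrite (_ : (e \o sigma) \o s = e)//; apply/funext => x /=.
by rewrite Ks.
Qed.

(** An automorphism of the big monster acts on [ext e j p] only through its values
    on [M], and over small parameters these can be moved into [C]. *)
Lemma act_ext_realization (K : Type) (u : K -> C) (g : M -> K) (a : I -> C)
    (sigma : aut C) (tau : aut C') :
  small kappa' K -> u \o g = j -> tp e (tau \o e \o j \o m) = p ->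
  realizes p u a -> sigma \o (j \o m) = a ->
  exists rho : aut C', rho \o (e \o u) = e \o u /\
    restrict_type e (act rho (act tau (ext e j p))) = act sigma p.
Proof.
move=> Ks ug tpb ua sa; have [m' mK Km] := m_bij.
have ba : same_type (sum_case (tau \o e \o j \o m) (e \o u)) (sum_case (e \o a) (e \o u)).
  move=> phi; rewrite -comp_sum_case sat_emb -(realizeE _ pc ua) -tpb /tp /=.
  by rewrite sat_ren sum_case_map.
have IKs := monster_small_sum hC' Is' Ks.
have [rho rhoE] := homogeneous_tuple hC' IKs ba.
exists rho; split; first by apply/funext => x; have := congr1 (@^~ (inr x)) rhoE.
have [tau3 t3E] := aut_extends sigma.
have [rt rtE] := aut_comp rho tau.
rewrite -(act_ext_restrict t3E) -(act_comp _ rtE); congr (restrict_type _ _).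
(* Both [rt] and [tau3] send the tuple [m] to [a], so they agree on [M]. *)
apply: (act_agree ext_j) => _ [x _ <-]; rewrite rtE -[x]Km.
have /= -> := congr1 (@^~ (inl (m' x))) rhoE.
by rewrite -sa; have := congr1 (@^~ (j (m (m' x)))) t3E.
Qed.

Variable pi : set (formula L (I + I)).
Hypothesis hstab : stab p = Gpi j m pi.

Lemma Gpi_realization (K : Type) q (u : K -> C) (g : M -> K) (a : I -> C)
    (sigma : aut C) : Sinv_pi j m pi q -> u \o g = j ->
  realizes q u a -> sigma \o (j \o m) = a -> Gpi j m pi sigma.
Proof.
move=> [_ qpi] ug ua sa psi /qpi qpsi; rewrite -compA sa.
have := realizes_comp (g \o m) ua; rewrite compA ug; exact.
Qed.

Lemma idempotent_Sinv_pi : diamond e j m p -> idempotent_type e j m p ->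
  Sinv_pi j m pi p.
Proof.
move=> hd idp; split=> // psi pipsi.
have [tau tpt] := tp_realized hp.
have tau_p : restrict_type e (act tau (ext e j p)) = p.
  apply: complete_type_max => // [phi rphi|phi].
    by rewrite -{1}idp; exists tau.
  apply: (act_complete tau (ren (sum_map id e) phi)).
  exact (ext_complete hC hC' e Ms Ms' Is' pc pj).
(* The translate is [M]-invariant by the diamond and restricts to [p], so uniqueness of the
   extension applies. *)
have tau_ext : act tau (ext e j p) = ext e j p.
  apply: (ext_unique hC hC' Ms Ms' Is' pc pj) => //.
  exact: (invariant_act (hd _ tpt)).
have [a ja] := realizes_exists hC j Is Ms pc.
have [sigma sa] := homogeneous_tuple hC Is (Sinv_same_type hp ja).
have [rho [rj rhoE]] := act_ext_realization Ms' (g := id) erefl tpt ja sa.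
(* [rho] fixes [M], so it acts trivially on the extension. *)
have : stab p sigma.
  rewrite /stab /= -rhoE tau_ext ext_j// => _ [x _ <-].
  by have := congr1 (@^~ x) rj.
rewrite hstab => /(_ _ pipsi); rewrite -compA sa => apsi.
exact/(realizeE psi pc (realizes_comp m ja)).
Qed.

Lemma Sinv_pi_idempotent : Sinv_pi j m pi p -> idempotent_type e j m p.
Proof.
move=> ppi.
have H (tau : aut C') : tp e (tau \o e \o j \o m) = p ->
    restrict_type e (act tau (ext e j p)) = p.
  move=> tpt; suff E phi : restrict_type e (act tau (ext e j p)) phi <-> p phi.
    by apply/seteqP; split=> phi /E.
  (* One formula is treated at a time: all of [C] is too large a parameter set for a realization
     inside [C]. *)
  have [l [g [w phiE]]] := finite_parameters phi.
  have lMs k (S : structure L) : monster k S -> small k M -> small k ('I_l + M)%type.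
    move=> hS kM; apply: (monster_small_sum hS _ kM).
    by apply: (small_finite (monster_infinite hS)); exact: finite_finset.
  have [a ua] := realizes_exists hC (sum_case w j) Is (lMs _ _ hC Ms) pc.
  have [sigma sa] := homogeneous_tuple hC Is (Sinv_same_type hp ua).
  have [rho [rw rhoE]] := act_ext_realization (lMs _ _ hC' Ms') (g := inr) erefl tpt ua sa.
  have : stab p sigma by rewrite hstab; exact: (Gpi_realization (g := inr) ppi erefl ua sa).
  rewrite /stab /= => sp; rewrite -phiE -[X in _ <-> X _]sp -rhoE.
  rewrite /restrict_type /= !(ren_ren _ (sum_map id e)) sum_map_comp.
  (* Since [rho] fixes [w], acting by it does not affect membership of formulas over [w]. *)
  have {2}-> : e \o w = rho \o (e \o w).
    by apply/funext => i; have := congr1 (@^~ (inl i)) rw.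
  by rewrite (act_ren _ rho).
apply/seteqP; split=> [phi [tau [/H tau_p]]|phi pphi]; first by rewrite tau_p.
by have [tau tpt] := tp_realized hp; exists tau; rewrite (H _ tpt).
Qed.

(** Exchanging two commuting realizations, [a] of [p] and [b] of [q]: left invariance
    replaces [m] by [a] in [q] and by [b] in [p]. *)
Lemma opposite_restriction q (chi : formula L (I + I)) :
  stably_tested j p -> Sinv_pi j m pi p -> Sinv_pi j m pi q ->
  left_invariant (Gpi j m pi) q ->
  q (ren (sum_map id (j \o m)) chi) ->
  p (ren (sum_map id (j \o m)) (ren (sum_case inr inl) chi)).
Proof.
move=> pst ppi qpi qG qchi; have [[qc qtp qj] _] := qpi.
have IMs := monster_small_sum hC Is Ms.
have [a ja] := realizes_exists hC j Is Ms pc.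
have [b jab] := realizes_exists hC (sum_case a j) Is IMs qc.
have jba : realizes p (sum_case b j) a.
  exact: (realizes_commute hC Is Ms (g := id) Ms erefl pc pj pst qc qj ja jab).
have [sigma sa] := homogeneous_tuple hC Is (Sinv_same_type hp ja).
have [beta bb] := homogeneous_tuple hC Is (Sinv_same_type qpi.1 jab).
have sG : Gpi j m pi sigma by exact: (Gpi_realization (g := id) ppi erefl ja sa).
have bG : stab p beta by rewrite hstab; exact: (Gpi_realization (g := inr) qpi erefl jab bb).
apply/(invariant_ren (j \o m) _ bG); rewrite bb.
have aE : sum_case a j \o inl = a by [].
have bE : sum_case b j \o inl = b by [].
have := realizes_comp inl jba; rewrite bE => /(realizeE _ pc) ->.
move/(invariant_ren (j \o m) _ (qG _ sG)): qchi; rewrite sa.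
have := realizes_comp inl jab; rewrite aE => /(realizeE _ qc) ->.
by rewrite sat_ren comp_sum_case.
Qed.

Lemma left_invariant_unique q :
  stably_tested j p -> Sinv_pi j m pi p -> Sinv_pi j m pi q ->
  left_invariant (Gpi j m pi) q -> q = p.
Proof.
move=> pst ppi qpi qG; have [[qc _ qj] _] := qpi.
have pG : left_invariant (Gpi j m pi) p by rewrite -hstab.
have [m' mK Km] := m_bij.
apply: (invariant_extension_unique hC Is Ms pc pj pst qc qj) => phi.
have -> : ren (sum_map id j) phi =
    ren (sum_map id (j \o m)) (ren (sum_map id m') phi).
  rewrite ren_ren sum_map_comp; congr (ren (sum_map _ _) _).
  by apply/funext => x /=; rewrite Km.
(* One swap passes from [q] to [p], the second from [p] to itself, and the two cancel. *)
move=> /(opposite_restriction pst ppi qpi qG) /(opposite_restriction pst ppi ppi pG).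
rewrite (ren_ren (sum_case inr inl) (sum_case inr inl)).
by rewrite (_ : _ \o _ = id) ?ren_id//; apply/funext; case.
Qed.

End ActExt.

End EnumeratedModel.

Theorem theorem3p16 (R : realType) (L : language)
    (T : theory L) (hT : complete_theory T)
    (kappa kappa' : Type) (C C' : structure L)
    (hCT : models C T)
    (hC : monster kappa C) (hC' : monster kappa' C')
    (e : elem_emb C C') (hCsmall : card_lt [set: C] [set: kappa'])
    (M : structure L) (j : elem_emb M C)
    (hMsmall : card_lt [set: M] [set: kappa])
    (I : Type) (m : I -> M) (hm : bijective m)
    (p : set (formula L (I + C))) (hp : Sinv j m p)
    (hgs : generically_stable R e j p)
    (hdiamond : diamond e j m p)
    (pi : set (formula L (I + I)))
    (hpi : partial_type T pi) (hpi_equiv : entails_equiv T pi)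
    (hstab : stab p = Gpi j m pi) :
  idempotent_type e j m p <->
  (Sinv_pi j m pi p /\ left_invariant (Gpi j m pi) p /\
   forall q : set (formula L (I + C)),
     Sinv_pi j m pi q -> left_invariant (Gpi j m pi) q -> q = p).
Proof.
have [pc _ pj] := hp.
have Ms' : small kappa' M := small_inj (@emb_inj _ _ _ j) hCsmall.
have Is' : small kappa' I := small_inj (bij_inj hm) Ms'.
have pst := generically_stable_tested hC hC' hMsmall Ms' Is' pc pj hgs.
split=> [idp|[ppi _]]; last exact: (Sinv_pi_idempotent hC hC' e hCsmall hMsmall hm hp hstab ppi).
have ppi : Sinv_pi j m pi p.
  exact: (idempotent_Sinv_pi hC hC' hCsmall hMsmall hm hp hstab hdiamond idp).
split=> //; split=> [|q]; first by rewrite -hstab.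
exact: (left_invariant_unique hC hMsmall hm hp hstab pst ppi).
Qed.
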